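(* Let $\delta>0$ and let $(T_k)_{k\in\mathbb N_0}$ be an increasing sequence of non-negative numbers with $T_0=0$, $$\lim_{k\to\infty}(T_{k+1}-T_k)=\infty\quad\text{and}\quad \lim_{k\to\infty}\frac{e^{T_{2k+2}-T_{2k+1}}}{T_{2k+1}-T_{2k}}=0 .$$ Define $A:[0,\infty)\to\mathbb R^{2\times2}$ by $$A(t)=\begin{pmatrix}-1&\delta\\0&-1\end{pmatrix}\ \text{ for } T_{2k}\le t< T_{2k+1},\qquad A(t)=\begin{pmatrix}-1&0\\0&0\end{pmatrix}\ \text{ for } T_{2k+1}\le t<T_{2k+2},\qquad k\in\mathbb N_0.$$ Let $f:[0,\infty)\times\mathbb R^2\to\mathbb R^2$ be continuous and suppose there are $r>0$, $L\ge1$ and $q>1$ with $$\|f(t,x)\|\le L\|x\|^q\quad\text{for all } t\ge0\text{ and } x\in B_r(0).$$ Then the trivial solution of $$\dot x=A(t)x+f(t,x)$$ is exponentially stable, i.e. there exist $K>0$, $\alpha>0$ and $\tilde\delta>0$ such that $$\|\varphi(t,0,x)\|\le Ke^{-\alpha t}\|x\|\quad\text{for all } t\ge0\text{ and } x\in B_{\tilde\delta}(0),$$ where $\varphi$ denotes the general solution of the nonlinear equation.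
   Context: $B_r(0)$ denotes the ball of radius $r$ around $0$ in $\mathbb R^2$. Solutions are understood as absolutely continuous functions satisfying the equation for almost every $t$. $\varphi(\cdot,0,x)$ denotes any maximal forward solution with value $x$ at time $0$; the conclusion includes that it exists on all of $[0,\infty)$. *)

(* Defs.v *)
From HB Require Import structures.
From mathcomp Require Import all_boot all_order all_algebra.
From mathcomp Require Import all_classical all_reals all_analysis.
Set Implicit Arguments.
Unset Strict Implicit.
Unset Printing Implicit Defensive.
Import Order.TTheory GRing.Theory Num.Theory.
Import numFieldNormedType.Exports.
Local Open Scope classical_set_scope.
Local Open Scope ring_scope.

(* The norm that the library puts on 'cV[R]_2 is the maximum norm; the
   Euclidean norm below induces the same topology. *)
Definition enorm (R : realType) (x : 'cV[R]_2) : R :=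
  Num.sqrt (\sum_i x i ord0 ^+ 2).

Definition mx2 (R : realType) (a b c d : R) : 'M[R]_2 :=
  \matrix_(i < 2, j < 2)
    if i == ord0 then (if j == ord0 then a else b)
    else (if j == ord0 then c else d).

(* Intervals [u i, v i] may share end points and may be degenerate; neither
   changes the notion. *)
Definition abs_continuous_on (R : realType) (a b : R) (phi : R -> 'cV[R]_2) :
    Prop :=
  forall e : R, 0 < e -> exists2 d : R, 0 < d &
    forall (n : nat) (u v : 'I_n -> R),
      (forall i, a <= u i /\ u i <= v i /\ v i <= b) ->
      (forall i j, i != j -> v i <= u j \/ v j <= u i) ->
      \sum_i (v i - u i) < d ->
      \sum_i enorm (phi (v i) - phi (u i)) < e.

(* phi solves x' = A(t) x + f(t,x), x(0) = x0, on an interval J of [0, +oo[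
   containing 0.  The values of phi outside J are irrelevant: they can only
   influence the derivative at the end points of J, a null set. *)
Definition forward_solution (R : realType) (A : R -> 'M[R]_2)
    (f : R -> 'cV[R]_2 -> 'cV[R]_2) (x0 : 'cV[R]_2)
    (J : set R) (phi : R -> 'cV[R]_2) : Prop :=
  [/\ is_interval J /\ J `<=` [set t | 0 <= t],
      J 0 /\ phi 0 = x0,
      forall a b, J a -> J b -> a <= b -> abs_continuous_on a b phi &
      {ae lebesgue_measure, forall t : R, J t ->
         is_derive t 1 phi (A t *m phi t + f t (phi t))}].

Definition maximal_forward_solution (R : realType) (A : R -> 'M[R]_2)
    (f : R -> 'cV[R]_2 -> 'cV[R]_2) (x0 : 'cV[R]_2)
    (J : set R) (phi : R -> 'cV[R]_2) : Prop :=
  forward_solution A f x0 J phi /\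
  forall (J' : set R) (psi : R -> 'cV[R]_2),
    forward_solution A f x0 J' psi -> J `<=` J' ->
    (forall t, J t -> psi t = phi t) -> J' = J.

(* Since f is only continuous, initial value problems need not be uniquely
   solvable, and the general solution at time t may have several values: the
   estimate is required for every maximal forward solution, and at least one
   has to exist. *)
Definition exponentially_stable (R : realType) (A : R -> 'M[R]_2)
    (f : R -> 'cV[R]_2 -> 'cV[R]_2) : Prop :=
  exists K alpha delta : R,
    [/\ 0 < K, 0 < alpha, 0 < delta &
     forall x : 'cV[R]_2, enorm x < delta ->
       (exists (J : set R) (phi : R -> 'cV[R]_2),
          maximal_forward_solution A f x J phi) /\
       (forall (J : set R) (phi : R -> 'cV[R]_2),
          maximal_forward_solution A f x J phi ->
          J = [set t | 0 <= t] /\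
          forall t, 0 <= t ->
            enorm (phi t) <= K * expR (- alpha * t) * enorm x)].

(* Main.v *)
Require Import Defs.
From HB Require Import structures.
From mathcomp Require Import all_boot all_order all_algebra.
From mathcomp Require Import all_classical all_reals all_analysis.
From mathcomp Require Import ring lra zify.
Set Implicit Arguments.
Unset Strict Implicit.
Unset Printing Implicit Defensive.
Import Order.TTheory GRing.Theory Num.Theory.
Import numFieldNormedType.Exports.
Local Open Scope classical_set_scope.
Local Open Scope ring_scope.

(** Write [c = 1 + delta ^ 2] and take the quadratic form
    [V x = x_1 ^ 2 + c * x_2 ^ 2] ([lyapunov]).  On the intervals
    [T_2k, T_2k+1[ the linear part of the equation gives [V' <= - V], because
    [2 * delta * x_1 * x_2 <= x_1 ^ 2 + delta ^ 2 * x_2 ^ 2]; on the intervals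
    [T_2k+1, T_2k+2[ it gives [V' <= 0].  So along a linear solution
    [V (t) <= V (0) * exp (- m t)], where [m t] is the time spent up to [t] in
    intervals of the first kind.  The hypothesis on
    [exp (T_2k+2 - T_2k+1) / (T_2k+1 - T_2k)] makes an interval of the second
    kind eventually shorter than the interval before it; hence
    [m t >= t / 2 - c0] for a constant [c0] ([decay_rate_half]), although
    the linear system is not uniformly exponentially stable.

    The perturbation adds at most [2 * c * L * |x| ^ (q - 1) * V] to [V'].  As
    long as [V * exp m < 2 * eta], the norm of [x] is below
    [kap * exp (- t / 4)], so that this term is integrable in time and, for
    small [eta], changes [V * exp m] by less than [eta].  This is expressed by
    the monotonicity of [V * exp m + eta * exp (- (q - 1) / 4 * t)]
    ([weighted_decay]), which carries the bound over from one interval to the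
    next ([lyapunov_bound]) and yields [exponential_bound].

    These computations need classical derivatives, while a solution is an
    absolutely continuous function that satisfies the equation almost
    everywhere.  A mean value inequality for absolutely continuous functions
    ([abs_continuous_increment]) shows that a solution is differentiable
    at every time at which the right-hand side is continuous, that is, at all
    positive times other than the [T_k].

    Solutions exist by the Euler method.  The polygons take values in bounded
    sets and converge pointwise along an ultrafilter; the limit is
    differentiable wherever the right-hand side is continuous
    ([exists_lipschitz_solution]).  Applied to the right-hand side cut off
    outside a small ball, this gives a global solution, which by the a priori
    bound never meets the cut-off, and it extends every small solution on a
    bounded interval beyond that interval ([forward_solution_continuation]).
    Hence small maximal solutions live on the whole half-line. *)

(** * Derivatives and increments *)

Lemma is_derive_increment (R : realType) (V : normedModType R) (x : R -> V)
    (s : R) (w : V) (e : R) :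
  is_derive s 1 x w -> 0 < e ->
  exists2 rho, 0 < rho &
    forall t, `|t - s| < rho -> `|x t - x s - (t - s) *: w| <= e * `|t - s|.
Proof.
move=> [dx wE] e0; move: dx.
rewrite /derivable => /cvg_ex[w' cw'].
have {wE} E : w' = w by rewrite -wE /derive; apply/esym/cvg_lim.
move: cw'; rewrite {w'}E => /cvgrPdist_le /(_ e e0).
rewrite near_withinE => /nbhs_normP[rho /= rho0 Hrho].
exists rho => // t tsrho.
have [->|nts] := eqVneq t s.
  by rewrite !subrr scale0r subr0 !normr0 mulr0.
have h0 : t - s != 0 by rewrite subr_eq0.
have /Hrho/(_ h0)/= : ball_ [eta Num.norm] 0 rho (t - s).
  by rewrite /ball_/= sub0r normrN.
rewrite /GRing.scale /= mulr1 subrK => H.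
rewrite distrC.
have -> : (t - s) *: w - (x t - x s) =
    (t - s) *: (w - (t - s)^-1 *: (x t - x s)).
  by rewrite [RHS]scalerBr scalerA divff // scale1r.
by rewrite normrZ mulrC ler_wpM2r.
Qed.

(** Increments over intervals that need not contain [s] are controlled here, so
    that the hypothesis is stable under pointwise limits and follows from a mean
    value inequality. *)
Lemma is_derive_of_increment (R : realType) (V : normedModType R) (x : R -> V)
    (s : R) (w : V) :
  (forall e : R, 0 < e -> exists2 rho : R, 0 < rho & forall u v,
     s - rho < u -> u <= v -> v < s + rho ->
     `|x v - x u - (v - u) *: w| <= e * (v - u)) ->
  is_derive s 1 x w.
Proof.
move=> H.
suff C : h^-1 *: ((x \o shift s) (h *: (1 : R)) - x s) @[h --> 0^'] --> w.
  by apply: DeriveDef; [apply/cvg_ex; exists w|apply: cvg_lim].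
apply/cvgrPdist_le => e e0; rewrite near_withinE.
have [rho rho0 {}H] := H _ e0.
apply/nbhs_normP; exists rho => //= h.
rewrite /ball_/= sub0r normrN => hrho h0.
rewrite /GRing.scale /= mulr1.
have -> : w - h^-1 *: (x (h + s) - x s) =
    h^-1 *: (h *: w - (x (h + s) - x s)).
  by rewrite [RHS]scalerBr scalerA mulVf // scale1r.
rewrite normrZ normfV ler_pdivrMl ?normr_gt0// mulrC.
move: hrho; rewrite ltr_norml => /andP[h1 h2].
have [hp|hn] := leP 0 h.
  have := H s (h + s); rewrite addrK (ger0_norm hp) distrC; apply; lra.
have := H (h + s) s; rewrite (ltr0_norm hn).
have -> : x s - x (h + s) - (s - (h + s)) *: w =
    h *: w - (x (h + s) - x s).
  by rewrite opprD addrCA subrr addr0 scaleNr opprK opprB addrC.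
have -> : s - (h + s) = - h by lra.
apply; lra.
Qed.

(** Induction along an interval.  The step leads from a point on the left of
    [x] to a point on its right, as the gauge of a Cousin covering does; the
    supremum of the points that satisfy [P] satisfies [P] and is [b]. *)
Lemma continuous_induction (R : realType) (a b : R) (P : R -> Prop) :
  a <= b -> P a ->
  (forall x, a <= x <= b -> exists2 rho : R, 0 < rho & forall u v,
     a <= u -> x - rho < u -> u <= x -> x <= v -> v < x + rho -> v <= b ->
     P u -> P v) ->
  P b.
Proof.
move=> ab Pa H.
pose S := [set x | a <= x <= b /\ P x].
have Sa : S a by split=> //; rewrite lexx ab.
have supS : has_sup S by split; [exists a|exists b => x [/andP[]]].
pose s := sup S.
have sS x : S x -> x <= s by move=> Sx; apply: sup_upper_bound.
have sb : s <= b by apply: ge_sup; [exists a|move=> x [/andP[]]].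
have as_ : a <= s := sS _ Sa.
have [rho rho0 Hrho] := H s (introT andP (conj as_ sb)).
have [u [/andP[au ub] Pu] su] := sup_adherent rho0 supS.
pose v := Num.min b (s + rho / 2).
have vb : v <= b by rewrite ge_min lexx.
have vs : s <= v by rewrite le_min sb; lra.
have vr : v < s + rho by rewrite gt_min; apply/orP; right; lra.
have Pv : P v by apply: (Hrho u) => //; apply: sS; split => //; apply/andP.
have : v <= s by apply: sS; split => //; apply/andP; split => //; lra.
rewrite ge_min => /orP[bs|]; last lra.
by have <- : v = b by apply/eqP; rewrite eq_le vb (le_trans bs).
Qed.

(** * Absolutely continuous curves in the plane *)

Lemma enorm_sqr (R : realType) (x : 'cV[R]_2) :
  enorm x ^+ 2 = x ord0 ord0 ^+ 2 + x (lift ord0 ord0) ord0 ^+ 2.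
Proof.
rewrite /enorm sqr_sqrtr; last by apply: sumr_ge0 => i _; exact: sqr_ge0.
by rewrite big_ord_recl big_ord1.
Qed.

Lemma enorm_ge0 (R : realType) (x : 'cV[R]_2) : 0 <= enorm x.
Proof. exact: sqrtr_ge0. Qed.

Lemma norm_entry (R : realType) (x : 'cV[R]_2) i : `|x i ord0| <= `|x|.
Proof.
rewrite [leRHS]mx_normrE.
by have /bigmax_leP[_ /(_ (i, ord0) isT)] :=
  lexx (\big[Num.max/0]_ij `|x ij.1 ij.2|).
Qed.

Lemma norm_le_entries (R : realType) (x : 'cV[R]_2) (e : R) : 0 <= e ->
  (forall i, `|x i ord0| <= e) -> `|x| <= e.
Proof.
move=> e0 H; rewrite [leLHS]mx_normrE; apply: bigmax_le => // -[i j] _ /=.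
by rewrite (ord1 j).
Qed.

Lemma norm_le_enorm (R : realType) (x : 'cV[R]_2) : `|x| <= enorm x.
Proof.
apply: norm_le_entries; first exact: enorm_ge0.
move=> i; rewrite -(sqrtr_sqr (x i ord0)) /enorm ler_wsqrtr//.
by rewrite (bigD1 i)//= lerDl; apply: sumr_ge0 => j _; exact: sqr_ge0.
Qed.

Lemma enorm_le_norm (R : realType) (x : 'cV[R]_2) : enorm x <= 2 * `|x|.
Proof.
rewrite -(@ler_pXn2r _ 2) ?nnegrE ?enorm_ge0 ?mulr_ge0//.
rewrite enorm_sqr exprMn.
have sq i : x i ord0 ^+ 2 <= `|x| ^+ 2.
  by rewrite -[leLHS]real_normK ?num_real// lerXn2r ?nnegrE ?norm_entry.
have := sq ord0; have := sq (lift ord0 ord0); have := sqr_ge0 `|x|; lra.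
Qed.

(** Outside a null set a derivative close to [w] controls the increments over
    short intervals around a point.  The null set has an open neighbourhood [U]
    of small measure, and the increments over nonoverlapping subintervals of
    [U] have a small sum by absolute continuity.  Continuous induction along
    [a, b] sorts the steps into these two kinds; the subintervals of [U] passed
    so far are recorded as [u i, v i], and comparing their total length with
    the measure of the part of [U] passed keeps it small. *)
Lemma abs_continuous_increment (R : realType) (phi : R -> 'cV[R]_2)
    (a b : R) (w : 'cV[R]_2) (e : R) :
  a <= b -> 0 <= e -> abs_continuous_on a b phi ->
  {ae lebesgue_measure, forall t : R, a <= t <= b ->
     exists2 v, is_derive t 1 phi v & `|v - w| <= e} ->
  `|phi b - phi a - (b - a) *: w| <= e * (b - a).
Proof.
move=> ab e0 AC [N [mN N0 subN]].
suff main : forall e1 : R, 0 < e1 ->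
    `|phi b - phi a - (b - a) *: w| <= e * (b - a) + e1 * (b - a + 2).
  apply/ler_addgt0Pr => e2 e20.
  have ba : 0 < b - a + 2 by lra.
  have := main (e2 / (b - a + 2)) (divr_gt0 e20 ba).
  by rewrite divfK// gt_eqF.
move=> e1 e10.
have [d d0 Hd] := AC e1 e10.
have w1 : 0 < `|w| + 1 by have := normr_ge0 w; lra.
pose d' := Num.min d (e1 / (`|w| + 1)).
have d'0 : 0 < d' by rewrite lt_min d0 divr_gt0.
have [U [oU NU mU]] := lebesgue_regularity_outer mN
  (eq_ind_r (fun x => (x < +oo)%E) (ltry 0) N0) d'0.
have measU : measurable U := measurable_realfun.open_measurable oU.
have {mU} mU : (lebesgue_measure U < d'%:E)%E.
  by rewrite -(setDKU NU) measureU0//; exact: measurableD.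
pose mu := @lebesgue_measure R.
(* [P x] : up to [x] the increment is bounded as required, apart from the
   contribution of finitely many nonoverlapping intervals inside [U]. *)
pose P x := exists n (u v : nat -> R),
  [/\ forall i, (i < n)%N -> a <= u i /\ u i <= v i /\ v i <= x,
      forall i j, (i < j)%N -> (j < n)%N -> v i <= u j,
      ((\sum_(i < n) (v i - u i))%:E <= mu (U `&` `[a, x]%classic))%E &
      `|phi x - phi a - (x - a) *: w| <= (e + e1) * (x - a) +
        \sum_(i < n) (enorm (phi (v i) - phi (u i)) + (v i - u i) * `|w|)].
have mono A B : measurable A -> measurable B -> A `<=` B -> (mu A <= mu B)%E.
  by move=> mA mB AB; apply: le_measure; rewrite ?inE.
have mUx x : measurable (U `&` `[a, x]%classic) by exact: measurableI.
have Pb : P b.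
  apply: (continuous_induction (P := P) ab).
    exists 0%N, (fun=> 0), (fun=> 0); split => //.
    - by rewrite big_ord0 measure_ge0.
    - by rewrite big_ord0 !subrr scale0r subr0 normr0 mulr0 addr0.
  move=> x axb.
  have split3 u v : phi v - phi a - (v - a) *: w =
      (phi u - phi a - (u - a) *: w) + (phi v - phi u - (v - u) *: w).
    by apply/matrixP => i j; rewrite !mxE; ring.
  (* The point [x] is either one with a good derivative, where the recorded
     family is kept, or one of the null set, where [u, v] joins it. *)
  have [[w' dw' w'w]|Hn] :=
    pselect (exists2 v, is_derive x 1 phi v & `|v - w| <= e).
    have [rho rho0 Hrho] := is_derive_increment dw' e10.
    exists rho => // u v au xu ux xv vx vb [n [us [vs [H1 H2 H3 H4]]]].
    exists n, us, vs; split => //.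
    - by move=> i /H1[? [? ?]]; do 2?split => //; lra.
    - apply: le_trans H3 _; apply: mono; [exact: mUx|exact: mUx|].
      apply: setIS => y /=; rewrite !in_itv/= => /andP[-> yu]/=; lra.
    rewrite (split3 u v).
    apply: le_trans (ler_normD _ _) _.
    have K1 : `|phi v - phi x - (v - x) *: w'| <= e1 * (v - x).
      by have := Hrho v; rewrite ger0_norm ?subr_ge0//; apply; lra.
    have K2 : `|phi u - phi x - (u - x) *: w'| <= e1 * (x - u).
      by have := Hrho u; rewrite ler0_norm ?subr_le0// opprB; apply; lra.
    have K3 : `|phi v - phi u - (v - u) *: w| <= (e + e1) * (v - u).
      have -> : phi v - phi u - (v - u) *: w =
         (phi v - phi x - (v - x) *: w') - (phi u - phi x - (u - x) *: w')
         + (v - u) *: (w' - w).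
        by apply/matrixP => i j; rewrite !mxE; ring.
      apply: le_trans (ler_normD _ _) _.
      rewrite normrZ ger0_norm; last lra.
      have : `|(phi v - phi x - (v - x) *: w') -
          (phi u - phi x - (u - x) *: w')| <= e1 * (v - u).
        by apply: le_trans (ler_normB _ _) _; lra.
      have : (v - u) * `|w' - w| <= (v - u) * e by apply: ler_wpM2l => //; lra.
      lra.
    lra.
  have Ux : U x.
    apply/NU/subN => /=; apply: contra_not Hn; exact.
  have /nbhs_normP[rho/= rho0 Hrho] := open_nbhs_nbhs (conj oU Ux).
  exists rho => // u v au xu ux xv vx vb [n [us [vs [H1 H2 H3 H4]]]].
  pose ext (f : nat -> R) (y : R) i := if (i < n)%N then f i else y.
  have extE f y (i : 'I_n) : ext f y i = f i by rewrite /ext ltn_ord.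
  have extn f y : ext f y n = y by rewrite /ext ltnn.
  exists n.+1, (ext us u), (ext vs v); split.
  - move=> i; rewrite /ext; case: ifP => [/H1[? [? ?]] _|_ _]; do 2?split => //; lra.
  - move=> i j ij jn; have iltn : (i < n)%N by apply: leq_trans ij _.
    rewrite /ext iltn; case: ifP => [jn'|_]; first exact: H2.
    by have [_ []] := H1 _ iltn.
  - rewrite big_ord_recr/= !extn.
    under eq_bigr do rewrite !extE.
    rewrite EFinD.
    have D : `]u, v]%classic `<=` U.
      move=> y /=; rewrite in_itv/= => /andP[uy yv]; apply: Hrho.
      rewrite /ball_/= distrC ltr_norml; lra.
    have -> : ((v - u)%:E = mu `]u, v]%classic)%E.
      rewrite /mu lebesgue_measure_itv/= lte_fin EFinB; case: ltP => // vu.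
      have -> : v = u by lra.
      by rewrite subee.
    apply: le_trans (leeD H3 (lexx _)) _.
    rewrite -measureU//.
    + apply: mono; [|exact: mUx|]; first by apply: measurableU; first exact: mUx.
      move=> y [[Uy /=]|uyv].
        by rewrite !in_itv/= => /andP[-> yu]; split => //=; lra.
      by split; [exact: D|move: uyv; rewrite /= !in_itv/=; lra].
    + exact: mUx.
    + by apply/seteqP; split => y //= -[[_]]; rewrite !in_itv/=; lra.
  rewrite big_ord_recr/= !extn.
  under eq_bigr do rewrite !extE.
  rewrite (split3 u v); apply: le_trans (ler_normD _ _) _.
  have K : `|phi v - phi u - (v - u) *: w| <= enorm (phi v - phi u) + (v - u) * `|w|.
    apply: le_trans (ler_normB _ _) _.
    by rewrite normrZ ger0_norm ?lerD ?norm_le_enorm//; lra.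
  have : 0 <= (e + e1) * (v - u) by apply: mulr_ge0; lra.
  lra.
move: Pb => [n [u [v [H1 H2 H3 H4]]]].
have len : \sum_(i < n) (v i - u i) < d'.
  rewrite -lte_fin; apply: le_lt_trans H3 _; apply: le_lt_trans mU.
  by apply: mono; [exact: mUx|exact: measU|exact: subIsetl].
move: len; rewrite lt_min => /andP[len1 len2].
have disj (i j : 'I_n) : i != j -> v i <= u j \/ v j <= u i.
  by rewrite neq_ltn => /orP[ij|ji]; [left|right]; exact: H2.
have small := Hd n (fun i : 'I_n => u i) (fun i : 'I_n => v i)
  (fun i => H1 i (ltn_ord i)) disj len1.
apply: le_trans H4 _.
rewrite big_split/= -mulr_suml.
have : (\sum_(i < n) (v i - u i)) * `|w| <= e1.
  apply: le_trans (_ : e1 / (`|w| + 1) * (`|w| + 1) <= _); last first.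
    by rewrite divfK ?gt_eqF.
  apply: ler_pM => //; [|exact: ltW|lra].
  by apply: sumr_ge0 => i _; have [_ [? _]] := H1 _ (ltn_ord i); lra.
nra.
Qed.

(** * Monotonicity and regularity *)

Lemma ae_lebesgueS (R : realType) (P Q : R -> Prop) :
  (forall t, P t -> Q t) ->
  {ae lebesgue_measure, forall t : R, P t} ->
  {ae lebesgue_measure, forall t : R, Q t}.
Proof.
move=> PQ [N [mN N0 subN]]; exists N; split => // t /= nQ.
by apply: subN => /= /PQ.
Qed.

(** A barrier argument: the sign of the derivative is known only where
    [g < c], but as long as this holds [g] stays below [g a < c], so it cannot
    reach [c]. *)
Lemma le_initial_of_derive_le0_below (R : realType) (g : R -> R) (a b c : R) :
  {within `[a, b], continuous g} -> g a < c ->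
  (forall t, a < t < b -> g t < c ->
     exists2 d, is_derive t 1 g d & d <= 0) ->
  forall t, a <= t <= b -> g t <= g a.
Proof.
move=> cg gac dg.
have mono x : a <= x -> x <= b -> (forall t, a <= t <= x -> g t < c) ->
    forall t, a <= t <= x -> g t <= g a.
  move=> ax xb H t /andP[at_ tx].
  have sub : `[a, x] `<=` `[a, b]%classic.
    by move=> y /=; rewrite !in_itv/= => /andP[-> yx]; exact: le_trans xb.
  have dx y : y \in `]a, x[ -> exists2 d, is_derive y 1 g d & d <= 0.
    rewrite in_itv/= => /andP[ay yx]; apply: dg.
      by rewrite ay (lt_le_trans yx).
    by apply: H; rewrite !ltW.
  apply: (ler0_derive1_le_cc (a := a) (b := x)) => //.
  - by move=> y /dx[d [+ _]].
  - by move=> y /dx[d dgd]; rewrite derive1E derive_val.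
  - exact: continuous_subspaceW sub cg.
  - by rewrite in_itv/= at_.
  - by rewrite in_itv/= lexx.
move=> t atb.
have ab : a <= b by case/andP: atb; exact: le_trans.
suff Pb : forall t, a <= t <= b -> g t < c by exact: (mono b).
apply: (continuous_induction (P := fun x => forall t, a <= t <= x -> g t < c) ab).
  by move=> y /andP[ay ya]; have -> : y = a by apply/eqP; rewrite eq_le ay ya.
move=> x axb.
have xin : `[a, b]%classic x by rewrite /= in_itv.
pose e := (c - g a) / 3.
have e0 : 0 < e by rewrite /e; lra.
move/subspace_continuousP: cg => /(_ x xin)/cvgrPdist_lt/(_ e e0).
rewrite near_withinE => /nbhs_normP[rho /= rho0 Hrho].
exists rho => // u v au xu ux xv vx vb Pu y /andP[ay yv].
have [yu|uy] := leP y u; first by apply: Pu; rewrite ay.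
have near z : u <= z -> z <= v -> `|g x - g z| < e.
  move=> uz zv; apply: Hrho; last by rewrite /= in_itv/=; lra.
  by rewrite /ball_/= ltr_norml; lra.
have gu : g u <= g a by apply: (mono u) => //; lra.
have := near u; have := near y; rewrite !ltr_norml /e; lra.
Qed.

Definition jointly_continuous_at (R : realType) (V : normedModType R)
    (F : R -> V -> V) (s : R) (x : V) : Prop :=
  forall e : R, 0 < e -> exists2 rho, 0 < rho &
    forall t y, `|t - s| < rho -> `|y - x| < rho -> `|F t y - F s x| <= e.

Lemma abs_continuous_sub (R : realType) (phi : R -> 'cV[R]_2) (a b a' b' : R) :
  a <= a' -> b' <= b -> abs_continuous_on a b phi -> abs_continuous_on a' b' phi.
Proof.
move=> aa bb AC e e0; have [d d0 Hd] := AC e e0; exists d => // n u v uv.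
by apply: Hd => i; have [? [? ?]] := uv i; do 2?split => //; lra.
Qed.

Lemma abs_continuous_cvg (R : realType) (phi : R -> 'cV[R]_2) (a b t e : R) :
  abs_continuous_on a b phi -> a <= t <= b -> 0 < e ->
  exists2 rho, 0 < rho &
    forall s, a <= s <= b -> `|s - t| < rho -> `|phi s - phi t| < e.
Proof.
move=> AC atb e0; have [rho rho0 Hrho] := AC e e0.
have one u v : a <= u -> u <= v -> v <= b -> v - u < rho -> `|phi v - phi u| < e.
  move=> au uv vb uvrho; apply: le_lt_trans (norm_le_enorm _) _.
  have := Hrho 1%N (fun=> u) (fun=> v); rewrite !big_ord1; apply => //.
  by move=> i j; rewrite !ord1 eqxx.
exists rho => // s asb; rewrite ltr_norml => /andP[h1 h2].
have [ts|st] := leP t s; first by apply: one; lra.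
by rewrite distrC; apply: one; lra.
Qed.

(** Near [s] the derivative of [phi] is almost everywhere close to
    [F s (phi s)] by continuity, so the mean value inequality applies with this
    vector on every short interval around [s]. *)
Lemma abs_continuous_solution_is_derive (R : realType) (phi : R -> 'cV[R]_2)
    (F : R -> 'cV[R]_2 -> 'cV[R]_2) (a b s : R) :
  abs_continuous_on a b phi ->
  {ae lebesgue_measure, forall t : R, a <= t <= b ->
     is_derive t 1 phi (F t (phi t))} ->
  a < s < b -> jointly_continuous_at F s (phi s) ->
  is_derive s 1 phi (F s (phi s)).
Proof.
move=> AC dphi asb cF; apply: is_derive_of_increment => e e0.
have [rho rho0 Hrho] := cF e e0.
have [d d0 Hd] := abs_continuous_cvg AC (t := s) (e := rho) ltac:(lra) rho0.
pose m := Num.min (Num.min rho d) (Num.min (s - a) (b - s)).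
have m0 : 0 < m by rewrite !lt_min rho0 d0; lra.
have [m1 m2 m3 m4] : [/\ m <= rho, m <= d, m <= s - a & m <= b - s].
  by rewrite /m !ge_min !lexx !orbT.
exists m => // u v su uv vs.
apply: (@abs_continuous_increment _ phi u v); [lra|lra| |].
  by apply: (abs_continuous_sub _ _ AC); lra.
move: dphi; apply: ae_lebesgueS => t dt utv.
exists (F t (phi t)); first by apply: dt; lra.
have ts : `|t - s| < m by rewrite ltr_norml; lra.
by apply: Hrho; [lra|apply: Hd; lra].
Qed.

(** * Existence of solutions by Euler polygons *)

Lemma le_of_small_error (R : realType) (A B K eta : R) : 0 < eta ->
  (forall e : R, 0 < e -> e <= eta -> A <= B + e * K) -> A <= B.
Proof.
move=> eta0 H; apply/ler_addgt0Pr => d d0.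
have K1 : 0 < `|K| + 1 by have := normr_ge0 K; lra.
pose e := Num.min eta (d / (`|K| + 1)).
have e0 : 0 < e by rewrite lt_min eta0 divr_gt0.
have ee : e <= eta by rewrite ge_min lexx.
have ed : e * (`|K| + 1) <= d by rewrite -ler_pdivlMr// ge_min lexx orbT.
have := H e e0 ee; have := ler_norm K; nra.
Qed.

(** Compactness of a product of bounded sets: the limit along an ultrafilter
    is approximated at any finite set of times by some [X n] with [n] large.
    Finitely many times are all that is needed to pass to the limit in a
    difference quotient. *)
Lemma pointwise_cluster (R : realType) (X : nat -> R -> 'cV[R]_2) (C : R -> R) :
  (forall n t, `|X n t| <= C t) ->
  exists x : R -> 'cV[R]_2, forall (ts : seq R) (e : R) (N : nat), 0 < e ->
    exists2 n, (N <= n)%N & forall t, t \in ts -> `|X n t - x t| < e.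
Proof.
move=> XC.
have [U [ultraU subU]] := ultraFilterLemma (F := nbhs (\oo : set_system nat)) _.
have lim (p : R * 'I_2) : {l : R | (fun n => X n p.1 p.2 ord0) @ U --> l}.
  pose f n := X n p.1 p.2 ord0.
  have fC : U [set n | `[- C p.1, C p.1]%classic (f n)].
    apply: filterS filterT => n _.
    by rewrite /= in_itv/= -ler_norml (le_trans (norm_entry _ _)).
  apply: cid; have [l [_ clusl]] :=
    @segment_compact R (- C p.1) (C p.1) (f @ U) _ fC.
  exists l => B Bl; rewrite /nbhs/=.
  have [//|nB] := in_ultra_setVsetC (f @^-1` B) ultraU.
  by have [y [/=]] := clusl (~` B) B nB Bl.
exists (fun t => \col_i sval (lim (t, i))) => ts e N e0.
have close :
    U [set n | forall t, t \in ts -> `|X n t - \col_i sval (lim (t, i))| < e].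
  elim: ts => [|t ts IH]; first by apply: filterS filterT => n _ t.
  have e2 : 0 < e / 2 by lra.
  have near_i (i : 'I_2) : U [set n | `|X n t i ord0 - sval (lim (t, i))| <= e / 2].
    have /cvgrPdist_le/(_ _ e2) := svalP (lim (t, i)).
    by apply: filterS => n /=; rewrite distrC.
  have near_all :
      U [set n | forall i : 'I_2, `|X n t i ord0 - sval (lim (t, i))| <= e / 2].
    apply: filterS2 (near_i ord0) (near_i (lift ord0 ord0)) => n H0 H1 i.
    by case: (unliftP ord0 i) => [j ->|->//]; rewrite (ord1 j).
  apply: filterS2 near_all IH => n H1 H2 t'; rewrite inE => /orP[/eqP->|/H2//].
  apply: (@le_lt_trans _ _ (e / 2)); last by lra.
  apply: norm_le_entries; first by lra.
  by move=> i; rewrite !mxE; exact: H1.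
have : U [set n | (N <= n)%N] by apply: subU; exact: nbhs_infty_ge.
move=> /(filterI close)/filter_ex[n [Hn Nn]].
by exists n.
Qed.

Fixpoint euler (R : realType) (V : normedModType R) (F : R -> V -> V)
    (b h : R) (x0 : V) (j : nat) : V :=
  if j is i.+1 then
    euler F b h x0 i + h *: F (b + i%:R * h) (euler F b h x0 i)
  else x0.

(** With [w = 0] this is the Lipschitz bound of the polygon. *)
Lemma euler_increment (R : realType) (V : normedModType R) (F : R -> V -> V)
    (b h : R) (x0 w : V) (e : R) (i k : nat) : 0 <= h ->
  (forall m, (i <= m < i + k)%N ->
     `|F (b + m%:R * h) (euler F b h x0 m) - w| <= e) ->
  `|euler F b h x0 (i + k) - euler F b h x0 i - (k%:R * h) *: w|
    <= e * (k%:R * h).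
Proof.
move=> h0; elim: k => [|k IH] H.
  by rewrite addn0 !mul0r mulr0 subrr scale0r subr0 normr0.
rewrite addnS /=.
set p := euler F b h x0 (i + k); set q := euler F b h x0 i.
set y := F _ p.
have -> : p + h *: y - q - (k.+1%:R * h) *: w =
    (p - q - (k%:R * h) *: w) + h *: (y - w).
  rewrite -natr1 mulrDl mul1r scalerDl scalerBr !opprD !addrA; congr (_ - _).
  by rewrite [RHS]addrC !addrA [h *: y + p]addrC.
apply: le_trans (ler_normD _ _) _.
rewrite normrZ (ger0_norm h0) -natr1 !mulrDl mul1r mulrDr; apply: lerD.
  by apply: IH => m /andP[im mk]; apply: H; rewrite im addnS ltnW.
by rewrite mulrC ler_wpM2r//; apply: H; rewrite leq_addr addnS leqnn.
Qed.

(** The nodes are read as a step function of time: at time [t] the current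
    index is [idx t].  Grid points miss [u] and [v] by up to [h], whence the
    additional terms. *)
Lemma euler_step_increment (R : realType) (V : normedModType R)
    (F : R -> V -> V) (b h u v : R) (x0 w : V) (e : R) :
  let idx t := Num.truncn ((t - b) / h) in
  0 < h -> b <= u -> u <= v -> 0 <= e ->
  (forall m, (idx u <= m <= idx v)%N -> u - h <= b + m%:R * h <= v ->
     `|F (b + m%:R * h) (euler F b h x0 m) - w| <= e) ->
  `|euler F b h x0 (idx v) - euler F b h x0 (idx u) - (v - u) *: w|
    <= e * (v - u + h) + h * `|w|.
Proof.
move=> idx h0 bu uv e0 H.
have itv t : b <= t -> (idx t)%:R * h <= t - b < (idx t).+1%:R * h.
  move=> bt; have /truncn_itv/andP[] : 0 <= (t - b) / h.
    by apply: divr_ge0; [lra|exact: ltW].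
  by rewrite -/(idx t) ler_pdivlMr// ltr_pdivrMr// => -> ->.
have iuv : (idx u <= idx v)%N.
  by apply: le_truncn; rewrite ler_pM2r ?invr_gt0//; lra.
have /andP[u1 u2] := itv u bu.
have /andP[v1 v2] := itv v (le_trans bu uv).
rewrite -natr1 mulrDl mul1r in u2; rewrite -natr1 mulrDl mul1r in v2.
have kE : (idx v - idx u)%:R * h = (idx v)%:R * h - (idx u)%:R * h.
  by rewrite natrB// mulrBl.
have := @euler_increment _ _ F b h x0 w e (idx u) (idx v - idx u) (ltW h0).
rewrite subnKC// kE => K.
have {}K := K _.
set p := euler F b h x0 (idx v) in K *; set q := euler F b h x0 (idx u) in K *.
set l := (idx v)%:R * h - (idx u)%:R * h in K.
have -> : p - q - (v - u) *: w = (p - q - l *: w) + (l - (v - u)) *: w.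
  by rewrite [(l - _) *: w]scalerBl addrA subrK.
apply: le_trans (ler_normD _ _) _; rewrite normrZ.
apply: lerD; last by apply: ler_wpM2r => //; rewrite ler_norml /l; lra.
apply: le_trans (K _) _; last by apply: ler_wpM2l => //; rewrite /l; lra.
move=> m /andP[im mj].
have im' : (idx u)%:R * h <= m%:R * h by rewrite ler_pM2r// ler_nat.
have mj' : m%:R * h <= (idx v)%:R * h by rewrite ler_pM2r// ler_nat ltnW.
by apply: H; [rewrite im ltnW|lra].
Qed.

(** A form of Peano's theorem for discontinuous right-hand sides: the equation
    holds wherever the limit of the Euler polygons meets a point of continuity
    of [F].  Near such a point all polygons that are close at time [s] move with
    velocity almost [F s (x s)], and this property of increments survives
    pointwise limits. *)
Lemma exists_lipschitz_solution (R : realType)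
    (F : R -> 'cV[R]_2 -> 'cV[R]_2) (M b : R) (x0 : 'cV[R]_2) :
  (forall t y, b <= t -> `|F t y| <= M) ->
  exists x : R -> 'cV[R]_2, [/\ x b = x0,
    forall u v, b <= u -> u <= v -> `|x v - x u| <= M * (v - u) &
    forall s, b < s -> jointly_continuous_at F s (x s) ->
      is_derive s 1 x (F s (x s))].
Proof.
move=> FM.
have M0 : 0 <= M by apply: le_trans (FM b 0 (lexx b)).
pose h n : R := n.+1%:R^-1.
have h0 n : 0 < h n by rewrite invr_gt0.
pose X n t := euler F b (h n) x0 (Num.truncn ((t - b) / h n)).
have Xlip n u v : b <= u -> u <= v -> `|X n v - X n u| <= M * (v - u + h n).
  move=> bu uv.
  have := @euler_step_increment _ _ F b (h n) u v x0 0 M (h0 n) bu uv M0.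
  rewrite scaler0 normr0 mulr0 addr0 subr0; apply.
  by move=> m _ _; rewrite subr0; apply: FM; rewrite lerDl mulr_ge0// ltW.
have Xb n : X n b = x0 by rewrite /X subrr mul0r truncn0.
have [x Hx] : exists x : R -> 'cV[R]_2,
    forall (ts : seq R) (e : R) (N : nat), 0 < e ->
    exists2 n, (N <= n)%N & forall t, t \in ts -> `|X n t - x t| < e.
  apply: (pointwise_cluster (C := fun t => `|x0| + M * (`|t - b| + 1))) => n t.
  have [bt|tb] := leP b t.
    have -> : X n t = X n b + (X n t - X n b) by rewrite addrC subrK.
    apply: le_trans (ler_normD _ _) _; rewrite Xb lerD2l -{1}(Xb n).
    apply: le_trans (Xlip n _ _ (lexx b) bt) _; apply: ler_wpM2l => //.
    rewrite ger0_norm ?subr_ge0// lerD2l /h invf_le1//.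
    by rewrite ler1n.
  have lt0 : (t - b) / h n < 0 by rewrite pmulr_llt0 ?invr_gt0// subr_lt0.
  rewrite /X truncn_floor (leNgt 0) lt0 /=.
  by rewrite lerDl mulr_ge0// addr_ge0.
have {}Hx (ts : seq R) (e : R) : 0 < e -> exists n, h n < e /\
    forall t, t \in ts -> `|X n t - x t| < e.
  move=> e0; have [n Nn Hn] := Hx ts e (Num.truncn e^-1) e0.
  exists n; split => //; rewrite /h invf_plt ?posrE//.
  have /andP[_ /lt_le_trans] := truncn_itv (ltW (etrans (invr_gt0 e) e0)).
  by apply; rewrite ler_nat ltnS.
exists x; split.
- apply/eqP; rewrite -subr_eq0 -normr_le0.
  apply: (@le_of_small_error _ _ _ 1 1) => // e e0 _.
  have [n [_ /(_ b)]] := Hx [:: b] e e0.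
  by rewrite mem_head Xb distrC => /(_ isT); lra.
- move=> u v bu uv.
  apply: (@le_of_small_error _ _ _ (M + 2) 1) => // e e0 _.
  have [n [hn Hn]] := Hx [:: u; v] e e0.
  have := Hn u; have := Hn v; rewrite !inE !eqxx orbT => /(_ isT) Kv /(_ isT) Ku.
  have -> : x v - x u = (X n v - X n u) - (X n v - x v) + (X n u - x u).
    by apply/matrixP => i j; rewrite !mxE; ring.
  apply: le_trans (ler_normD _ _) _.
  have := ler_normB (X n v - X n u) (X n v - x v).
  have := Xlip n _ _ bu uv; have := ltW hn; have := h0 n; nra.
move=> s bs cF; apply: is_derive_of_increment => e e0.
set w := F s (x s) in cF *.
have [rho rho0 Hrho] := cF e e0.
(* If [u] and [v] are within [eta] of [s] and the step is below [eta], then a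
   polygon with velocity at most [M] moves by at most [5 * M * eta], and the
   nodes in between stay within [rho] of [(s, x s)]. *)
pose eta := rho / (8 * (M + 1)).
have M8 : 0 < 8 * (M + 1) by lra.
have etaE : eta * (8 * (M + 1)) = rho by rewrite divfK// gt_eqF.
have eta0 : 0 < eta by rewrite divr_gt0.
exists (Num.min eta (s - b)); first by rewrite lt_min eta0; lra.
have [m1 m2] : Num.min eta (s - b) <= eta /\ Num.min eta (s - b) <= s - b.
  by rewrite !ge_min !lexx orbT.
move: (Num.min _ _) m1 m2 => d m1 m2 u v su uv vs.
apply: (@le_of_small_error _ _ _ (2 + e + `|w|) eta) => // d1 d10 d1eta.
have [n [hn Hn]] := Hx [:: u; v; s] d1 d10.
have := Hn u; have := Hn v; have := Hn s.
rewrite !inE !eqxx !orbT => /(_ isT) Ks /(_ isT) Kv /(_ isT) Ku.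
have hn0 := h0 n.
have K : `|X n v - X n u - (v - u) *: w| <= e * (v - u + h n) + h n * `|w|.
  apply: euler_step_increment => //; [lra|exact: ltW|].
  move=> m /andP[um mv] /andP[um' mv'].
  apply: Hrho; first by rewrite ltr_norml; nra.
  have Kus : `|X n u - X n s| <= M * (eta + h n).
    have [us|su'] := leP u s.
      rewrite distrC; apply: le_trans (Xlip n _ _ _ us) _; first lra.
      by apply: ler_wpM2l => //; lra.
    apply: le_trans (Xlip n _ _ _ (ltW su')) _; first lra.
    by apply: ler_wpM2l => //; lra.
  have Kmu : `|euler F b (h n) x0 m - X n u| <= M * (2 * eta + h n).
    have := @euler_increment _ _ F b (h n) x0 0 M
      (Num.truncn ((u - b) / h n)) (m - Num.truncn ((u - b) / h n)) (ltW hn0).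
    rewrite subnKC// scaler0 subr0 natrB// => T.
    apply: le_trans (T _) _.
      by move=> k _; rewrite subr0; apply: FM; rewrite lerDl mulr_ge0// ltW.
    apply: ler_wpM2l => //; rewrite mulrBl.
    have : 0 <= (u - b) / h n by apply: divr_ge0; lra.
    move=> /truncn_itv/andP[_]; rewrite ltr_pdivrMr// -natr1 mulrDl mul1r.
    lra.
  have -> : euler F b (h n) x0 m - x s =
      (euler F b (h n) x0 m - X n u) + (X n u - X n s) + (X n s - x s).
    by apply/matrixP => i j; rewrite !mxE; ring.
  apply: le_lt_trans (ler_normD _ _) _.
  have := ler_normD (euler F b (h n) x0 m - X n u) (X n u - X n s).
  nra.
have -> : x v - x u - (v - u) *: w =
    (X n v - X n u - (v - u) *: w) - (X n v - x v) + (X n u - x u).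
  by apply/matrixP => i j; rewrite !mxE; ring.
apply: le_trans (ler_normD _ _) _.
have := ler_normB (X n v - X n u - (v - u) *: w) (X n v - x v).
have := normr_ge0 w; nra.
Qed.

(** * The Lyapunov function *)

(** The weight [1 + delta ^ 2] of the second coordinate absorbs the coupling
    term [delta * x_1 * x_2] of the first phase. *)
Definition lyapunov (R : realType) (delta : R) (x : 'cV[R]_2) : R :=
  x ord0 ord0 ^+ 2 + (1 + delta ^+ 2) * x (lift ord0 ord0) ord0 ^+ 2.

(** The symmetric bilinear form of [lyapunov]: half the derivative of
    [lyapunov] at [x] in the direction [y]. *)
Definition lyapunov_polar (R : realType) (delta : R) (x y : 'cV[R]_2) : R :=
  x ord0 ord0 * y ord0 ord0 +
  (1 + delta ^+ 2) * (x (lift ord0 ord0) ord0 * y (lift ord0 ord0) ord0).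

Lemma enorm_le_lyapunov (R : realType) (delta : R) (x : 'cV[R]_2) :
  enorm x ^+ 2 <= lyapunov delta x.
Proof.
rewrite enorm_sqr /lyapunov.
have := sqr_ge0 (x (lift ord0 ord0) ord0); have := sqr_ge0 delta; nra.
Qed.

Lemma lyapunov_le_enorm (R : realType) (delta : R) (x : 'cV[R]_2) :
  lyapunov delta x <= (1 + delta ^+ 2) * enorm x ^+ 2.
Proof.
rewrite enorm_sqr /lyapunov.
have := sqr_ge0 (x ord0 ord0); have := sqr_ge0 delta; nra.
Qed.

Lemma lyapunov_ge0 (R : realType) (delta : R) (x : 'cV[R]_2) :
  0 <= lyapunov delta x.
Proof. by apply: le_trans (enorm_le_lyapunov _ _); exact: sqr_ge0. Qed.

(** This is the Cauchy-Schwarz inequality for each of the forms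
    [x_1 * y_1 + x_2 * y_2] and [x_2 * y_2]. *)
Lemma lyapunov_polar_le (R : realType) (delta : R) (x y : 'cV[R]_2) :
  lyapunov_polar delta x y <= (1 + delta ^+ 2) * (enorm x * enorm y).
Proof.
rewrite /lyapunov_polar.
have x2 := enorm_sqr x; have y2 := enorm_sqr y.
have nx := enorm_ge0 x; have ny := enorm_ge0 y.
move: (enorm x) (enorm y) x2 y2 nx ny => n k.
move: (x ord0 ord0) (x (lift ord0 ord0) ord0) (y ord0 ord0)
  (y (lift ord0 ord0) ord0) => x1 x2 y1 y2 E1 E2 n0 k0.
have nk : 0 <= n * k by apply: mulr_ge0.
have sq (u v : R) : 0 <= v -> u ^+ 2 <= v ^+ 2 -> u <= v.
  move=> v0; have [u0|u0 _] := leP 0 u; last by apply: ltW; apply: lt_le_trans v0.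
  by rewrite ler_pXn2r ?nnegrE.
have d2 := sqr_ge0 delta.
have E : (n * k) ^+ 2 = (x1 ^+ 2 + x2 ^+ 2) * (y1 ^+ 2 + y2 ^+ 2).
  by rewrite exprMn E1 E2.
have K1 : x1 * y1 + x2 * y2 <= n * k.
  apply: sq => //; rewrite E; have := sqr_ge0 (x1 * y2 - x2 * y1); nra.
have K2 : x2 * y2 <= n * k.
  apply: sq => //; rewrite E.
  have := sqr_ge0 (x1 * y2); have := sqr_ge0 (x2 * y1); have := sqr_ge0 (x1 * y1); nra.
nra.
Qed.

Lemma mx2_mul0 (R : realType) (a b c d : R) (x : 'cV[R]_2) :
  (mx2 a b c d *m x) ord0 ord0 = a * x ord0 ord0 + b * x (lift ord0 ord0) ord0.
Proof. by rewrite !mxE big_ord_recl big_ord1 !mxE. Qed.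

Lemma mx2_mul1 (R : realType) (a b c d : R) (x : 'cV[R]_2) :
  (mx2 a b c d *m x) (lift ord0 ord0) ord0 =
  c * x ord0 ord0 + d * x (lift ord0 ord0) ord0.
Proof. by rewrite !mxE big_ord_recl big_ord1 !mxE. Qed.

Definition phase (R : realType) (delta : R) (k : nat) : 'M[R]_2 :=
  if odd k then mx2 (-1) 0 0 0 else mx2 (-1) delta 0 (-1).

Definition rate (R : realType) (k : nat) : R := (~~ odd k)%:R.

(** For even [k] the square of [x_1 - delta * x_2] accounts for the coupling;
    for odd [k] only [- 2 * x_1 ^ 2] is left. *)
Lemma phase_dissipative (R : realType) (delta : R) (k : nat) (x : 'cV[R]_2) :
  2 * lyapunov_polar delta x (phase delta k *m x)
    <= - rate R k * lyapunov delta x.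
Proof.
rewrite /lyapunov_polar /lyapunov /phase /rate.
case: odd; rewrite mx2_mul0 mx2_mul1 /=.
  by have := sqr_ge0 (x ord0 ord0); nra.
have := sqr_ge0 (x ord0 ord0 - delta * x (lift ord0 ord0) ord0).
have := sqr_ge0 (x (lift ord0 ord0) ord0).
nra.
Qed.

Lemma is_derive_entry (R : realType) (phi : R -> 'cV[R]_2) (t : R)
    (v : 'cV[R]_2) (i : 'I_2) :
  is_derive t 1 phi v -> is_derive t 1 (fun s => phi s i ord0) (v i ord0).
Proof.
move=> [dphi E]; have D : forall j k, derivable (fun s => phi s j k) t 1.
  exact/derivable_mxP.
apply: DeriveDef; first exact: D.
by rewrite -E derive_mx// mxE.
Qed.

Lemma is_derive_lyapunov (R : realType) (delta : R) (phi : R -> 'cV[R]_2)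
    (t : R) (v : 'cV[R]_2) :
  is_derive t 1 phi v ->
  is_derive t 1 (fun s => lyapunov delta (phi s))
    (2 * lyapunov_polar delta (phi t) v).
Proof.
move=> dphi.
have d0 := is_derive_entry ord0 dphi.
have d1 := is_derive_entry (lift ord0 ord0) dphi.
have D := is_deriveD (is_deriveX 2 d0)
  (is_deriveZ (1 + delta ^+ 2) (is_deriveX 2 d1)).
apply: (is_derive_eq D).
by rewrite /lyapunov_polar /GRing.scale /= !expr1; ring.
Qed.

Lemma is_derive_expR_affine (R : realType) (c d t : R) :
  is_derive t (1 : R) (fun s => expR (c + d * s)) (d * expR (c + d * t)).
Proof.
have D : is_derive t (1 : R) (fun s => c + d * s) d.
  have D := is_deriveD (is_derive_cst c t 1) (is_deriveZ d (is_derive_id t 1)).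
  by apply: (is_derive_eq D); rewrite add0r /GRing.scale /= mulr1.
have := @is_derive1_comp _ expR (fun s => c + d * s) t _ _
  (is_derive_expR (c + d * t)) D.
by rewrite mulrC.
Qed.

Lemma continuous_within_lyapunov (R : realType) (delta : R)
    (phi : R -> 'cV[R]_2) (J : set R) :
  {within J, continuous phi} ->
  {within J, continuous (fun s => lyapunov delta (phi s))}.
Proof.
move=> /subspace_continuousP cphi; apply/subspace_continuousP => t Jt.
have ce i : phi s i ord0 @[s --> within J (nbhs t)] --> phi t i ord0.
  exact: (cvg_comp phi (fun M : 'cV[R]_2 => M i ord0) (cphi t Jt)
    (@coord_continuous R 2 1 i ord0 (phi t))).
have ce2 i : phi s i ord0 ^+ 2 @[s --> within J (nbhs t)] --> phi t i ord0 ^+ 2.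
  by under eq_fun do rewrite expr2; rewrite expr2; apply: cvgM; exact: ce.
by apply: cvgD; [exact: ce2|apply: cvgM; [exact: cvg_cst|exact: ce2]].
Qed.

(** * Decay of the Lyapunov function on one interval *)

(** The second term decreases in [t] at the rate at which the perturbation can
    increase the first one. The summand [0] gives both exponents the same affine
    form. *)
Definition weighted (R : realType) (delta eta gam c lam : R)
    (phi : R -> 'cV[R]_2) (t : R) : R :=
  lyapunov delta (phi t) * expR (c + lam * t) + eta * expR (0 + - gam * t).

Lemma is_derive_weighted (R : realType) (delta eta gam c lam t : R)
    (phi : R -> 'cV[R]_2) (v : 'cV[R]_2) :
  is_derive t 1 phi v ->
  is_derive t 1 (weighted delta eta gam c lam phi)
    ((2 * lyapunov_polar delta (phi t) v + lam * lyapunov delta (phi t))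
       * expR (c + lam * t) - eta * gam * expR (0 + - gam * t)).
Proof.
move=> dphi.
have D := is_deriveD
  (is_deriveM (is_derive_lyapunov delta dphi) (is_derive_expR_affine c lam t))
  (is_deriveZ eta (is_derive_expR_affine 0 (- gam) t)).
apply: (is_derive_eq D).
by rewrite /GRing.scale /=; ring.
Qed.

Lemma continuous_within_weighted (R : realType) (delta eta gam c lam : R)
    (phi : R -> 'cV[R]_2) (J : set R) :
  {within J, continuous phi} ->
  {within J, continuous (weighted delta eta gam c lam phi)}.
Proof.
move=> /(continuous_within_lyapunov (delta := delta))/subspace_continuousP cV.
apply/subspace_continuousP => t Jt.
have ce c' d : expR (c' + d * s) @[s --> within J (nbhs t)] --> expR (c' + d * t).
  apply: cvg_within_filter.
  have [/derivable1_diffP/differentiable_continuous dX _] :=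
    is_derive_expR_affine c' d t.
  exact: dX.
apply: cvgD; first by apply: cvgM; [exact: cV|exact: ce].
by apply: cvgM; [exact: cvg_cst|exact: ce].
Qed.

(** The bound [weighted < 2 * eta] gives
    [|phi t| ^ 2 < 2 * eta * exp (c0 - t / 2) <= kap ^ 2 * exp (- t / 2)]. *)
Lemma enorm_lt_of_weighted (R : realType) (delta eta c0 gam c lam kap t : R)
    (phi : R -> 'cV[R]_2) :
  0 < eta -> 0 < kap -> 2 * eta * expR c0 <= kap ^+ 2 ->
  t / 2 - c0 <= c + lam * t ->
  weighted delta eta gam c lam phi t < 2 * eta ->
  enorm (phi t) < kap * expR (- (t / 4)).
Proof.
move=> eta0 kap0 heta hm; rewrite /weighted => W.
set E := expR (c + lam * t) in W.
have E0 : 0 < E by exact: expR_gt0.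
have ET : expR (t / 2 - c0) <= E by rewrite ler_expR.
have V2 : enorm (phi t) ^+ 2 * E < 2 * eta.
  have := expR_gt0 (0 + - gam * t).
  have := enorm_le_lyapunov delta (phi t); nra.
have key : enorm (phi t) ^+ 2 < (kap * expR (- (t / 4))) ^+ 2.
  rewrite exprMn -expRM_natl.
  have -> : 2%:R * - (t / 4) = - (t / 2) :> R by lra.
  have C0 := expR_gt0 c0; have T0 := expR_gt0 (t / 2).
  have TN0 := expR_gt0 (- (t / 2)).
  have TT : expR (t / 2) * expR (- (t / 2)) = 1 by rewrite -expRD subrr expR0.
  have CC : expR (t / 2 - c0) * expR c0 = expR (t / 2) by rewrite -expRD subrK.
  have n0 := sqr_ge0 (enorm (phi t)).
  have S1 : enorm (phi t) ^+ 2 * expR (t / 2 - c0) < 2 * eta.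
    by apply: le_lt_trans V2; apply: ler_wpM2l.
  have S2 : enorm (phi t) ^+ 2 * expR (t / 2) < kap ^+ 2.
    by apply: lt_le_trans heta; rewrite -CC mulrA ltr_pM2r.
  have : enorm (phi t) ^+ 2 * expR (t / 2) * expR (- (t / 2)) <
      kap ^+ 2 * expR (- (t / 2)) by rewrite ltr_pM2r.
  by rewrite -mulrA TT mulr1.
have k0 : 0 <= kap * expR (- (t / 4)) by rewrite mulr_ge0 ?ltW ?expR_gt0.
by rewrite -(@ltr_pXn2r _ 2) ?nnegrE ?enorm_ge0.
Qed.

(** While [g < 2 * eta], [enorm_lt_of_weighted] bounds the factor
    [|phi| ^ (q - 1)] of the perturbation by [kap ^ (q - 1) * exp (- gam * t)].
    The derivative of the first term of [g] is then at most
    [4 * (1 + delta ^ 2) * L * kap ^ (q - 1) * eta * exp (- gam * t)], and the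
    smallness of [kap] makes this at most [gam * eta * exp (- gam * t)], which
    is the decrease of the second term.  So [g] cannot leave the region
    [g < 2 * eta], by [le_initial_of_derive_le0_below]. *)
Lemma weighted_decay (R : realType) (delta L q kap eta c0 c lam a b : R)
    (B : 'M[R]_2) (phi : R -> 'cV[R]_2) :
  let gam := (q - 1) / 4 in
  let g := weighted delta eta gam c lam phi in
  0 <= L -> 1 < q -> 0 < kap -> 0 < eta -> 0 <= a ->
  4 * (1 + delta ^+ 2) * L * powR kap (q - 1) <= gam ->
  2 * eta * expR c0 <= kap ^+ 2 ->
  (forall x, 2 * lyapunov_polar delta x (B *m x) <= - lam * lyapunov delta x) ->
  (forall t, a <= t <= b -> t / 2 - c0 <= c + lam * t) ->
  {within `[a, b], continuous phi} ->
  (forall t, a < t < b -> enorm (phi t) < kap ->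
     exists2 z, is_derive t 1 phi (B *m phi t + z) &
       enorm z <= L * powR (enorm (phi t)) q) ->
  g a < 2 * eta -> forall t, a <= t <= b -> g t <= g a.
Proof.
move=> gam g L0 q1 kap0 eta0 a0 hsmall heta hB hm cphi dphi ga.
apply: (le_initial_of_derive_le0_below (c := 2 * eta)) => //.
  exact: continuous_within_weighted.
move=> t atb gt.
have t0 : 0 <= t by lra.
have hmt : t / 2 - c0 <= c + lam * t by apply: hm; lra.
have n_lt := enorm_lt_of_weighted eta0 kap0 heta hmt gt.
have e1 : expR (- (t / 4)) <= 1 by rewrite expR_le1; lra.
have n_kap : enorm (phi t) < kap.
  apply: lt_le_trans n_lt _; have := expR_gt0 (- (t / 4)); nra.
have [z dz zL] := dphi t atb n_kap.
exists ((2 * lyapunov_polar delta (phi t) (B *m phi t + z)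
          + lam * lyapunov delta (phi t)) * expR (c + lam * t)
        - eta * gam * expR (0 + - gam * t)).
  exact: is_derive_weighted.
have polarD : lyapunov_polar delta (phi t) (B *m phi t + z) =
    lyapunov_polar delta (phi t) (B *m phi t) + lyapunov_polar delta (phi t) z.
  by rewrite /lyapunov_polar !mxE; ring.
have := hB (phi t); have := lyapunov_polar_le delta (phi t) z.
rewrite polarD.
have n0 := enorm_ge0 (phi t).
have Vn := enorm_le_lyapunov delta (phi t).
set G := expR (0 + - gam * t).
have G0 : 0 < G by exact: expR_gt0.
have pw : powR (enorm (phi t)) (q - 1) <= powR kap (q - 1) * G.
  have -> : G = powR (expR (- (t / 4))) (q - 1).
    by rewrite -expRM /G /gam; congr expR; field.
  rewrite -powRM ?(ltW kap0) ?(ltW (expR_gt0 _))//.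
  apply: ge0_ler_powR; rewrite ?nnegrE; [lra|exact: n0|..|exact: ltW].
  by rewrite mulr_ge0 ?ltW ?expR_gt0.
have nq : powR (enorm (phi t)) q = enorm (phi t) * powR (enorm (phi t)) (q - 1).
  by rewrite mulr_powRB1//; lra.
move: gt; rewrite /g /weighted -/G.
rewrite nq in zL.
set E := expR (c + lam * t).
have E0 : 0 < E by exact: expR_gt0.
have d2 := sqr_ge0 delta.
set V := lyapunov delta (phi t) in Vn *.
set n := enorm (phi t) in n0 Vn pw zL *.
set P := powR n (q - 1) in pw zL.
set K := powR kap (q - 1) in pw hsmall.
set p2 := lyapunov_polar delta (phi t) z.
set p1 := lyapunov_polar delta (phi t) _.
move=> gt H2 H1.
have P0 : 0 <= P by exact: powR_ge0.
have V0 : 0 <= V by exact: lyapunov_ge0.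
have K0 : 0 <= K by exact: powR_ge0.
have VE : V * E <= 2 * eta by have := mulr_gt0 eta0 G0; lra.
have VE0 : 0 <= V * E by rewrite mulr_ge0 // ltW.
have D0 : 0 <= 1 + delta ^+ 2 by lra.
have B1 : p2 <= (1 + delta ^+ 2) * L * (K * G) * V.
  apply: le_trans H2 _.
  have -> : (1 + delta ^+ 2) * L * (K * G) * V =
      (1 + delta ^+ 2) * (L * ((K * G) * V)) by ring.
  apply: ler_wpM2l => //.
  have : n * enorm z <= n * (L * (n * P)) by apply: ler_wpM2l.
  have -> : n * (L * (n * P)) = L * (P * n ^+ 2) by ring.
  move=> M1; apply: (le_trans M1); apply: ler_wpM2l => //.
  by apply: ler_pM => //; exact: sqr_ge0.
have B2 : (2 * (p1 + p2) + lam * V) * E <=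
    2 * ((1 + delta ^+ 2) * L * K * G) * (V * E).
  have -> : 2 * ((1 + delta ^+ 2) * L * K * G) * (V * E) =
      (2 * ((1 + delta ^+ 2) * L * (K * G) * V)) * E by ring.
  by rewrite ler_pM2r//; lra.
have B3 : 2 * ((1 + delta ^+ 2) * L * K * G) * (V * E) <=
    2 * ((1 + delta ^+ 2) * L * K * G) * (2 * eta).
  by apply: ler_wpM2l => //; rewrite !mulr_ge0// ltW.
have B4 : 4 * (1 + delta ^+ 2) * L * K * (eta * G) <= gam * (eta * G).
  by rewrite ler_wpM2r// mulr_ge0// ltW.
lra.
Qed.

(** * Exponential bound for small solutions *)

Lemma eventually_nondecreasing_bounded_below (R : realType) (D : nat -> R)
    (N : nat) :
  (forall j, (N <= j)%N -> D j <= D j.+1) -> exists c, forall j, - c <= D j.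
Proof.
move=> inc; exists (\sum_(i < N.+1) `|D i|) => j.
have small i : (i <= N)%N -> - (\sum_(i < N.+1) `|D i|) <= D i.
  move=> iN; have iN' : (i < N.+1)%N by rewrite ltnS.
  rewrite lerNl; apply: le_trans (ler_norm _) _.
  rewrite normrN (bigD1 (Ordinal iN'))//= lerDl.
  by apply: sumr_ge0 => k _; exact: normr_ge0.
have [jN|/ltnW Nj] := leqP j N; first exact: small.
rewrite -(subnKC Nj); elim: (j - N)%N => [|k IH].
  by rewrite addn0; exact: small.
by rewrite addnS; apply: le_trans IH (inc _ (leq_addr _ _)).
Qed.

Lemma unbounded_of_gap (R : realType) (T : nat -> R) :
  (T k.+1 - T k) @[k --> \oo] --> +oo -> forall M, exists k, M < T k.
Proof.
move=> /cvgryPge/(_ 1)[N _ HN] M.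
have lin j : T N + j%:R <= T (N + j)%N.
  elim: j => [|j IH]; first by rewrite addn0 addr0.
  have := HN (N + j)%N (leq_addr _ _); rewrite /= addnS -natr1; lra.
exists (N + (Num.truncn `|M - T N|%R).+1)%N.
apply: lt_le_trans (lin _).
have /andP[_] := truncn_itv (normr_ge0 (M - T N)).
have := ler_norm (M - T N); lra.
Qed.

Lemma exists_interval (R : realType) (T : nat -> R) (t : R) :
  T 0%N <= t -> (exists k, t < T k) -> exists k, T k <= t < T k.+1.
Proof.
move=> T0 ex; have [[|k] tk min] := ex_minnP ex; first by lra.
exists k; rewrite tk andbT leNgt; apply/negP => /min.
by rewrite ltnn.
Qed.

(** The time spent in phases of even index before [T k]. *)
Definition decay (R : realType) (T : nat -> R) (k : nat) : R :=
  \sum_(i < k) rate R i * (T i.+1 - T i).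

Lemma decayS (R : realType) (T : nat -> R) (k : nat) :
  decay T k.+1 = decay T k + rate R k * (T k.+1 - T k).
Proof. by rewrite /decay big_ord_recr. Qed.

(** The right-hand side is the time spent in even phases up to [t].  Its
    difference with [t / 2] increases on even phases and decreases on odd ones,
    so it is smallest at the times [T_2j]; from one of these to the next it
    changes by half the difference of the lengths of the two phases, which is
    eventually nonnegative. *)
Lemma decay_rate_half (R : realType) (T : nat -> R) :
  (forall k, T k < T k.+1) ->
  (\forall k \near \oo,
    T (2 * k + 2)%N - T (2 * k + 1)%N <= T (2 * k + 1)%N - T (2 * k)%N) ->
  exists c0, forall k t, T k <= t <= T k.+1 ->
    t / 2 - c0 <= (decay T k - rate R k * T k) + rate R k * t.
Proof.
move=> Tinc [N _ HN].
pose D j := decay T (2 * j)%N - T (2 * j)%N / 2.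
have step j : (2 * j.+1 = (2 * j).+2)%N by lia.
have odd2 j : odd (2 * j) = false by rewrite mul2n odd_double.
have rate0 j : rate R (2 * j) = 1 by rewrite /rate odd2.
have rate1 j : rate R (2 * j).+1 = 0 by rewrite /rate /= odd2.
have inc j : (N <= j)%N -> D j <= D j.+1.
  move=> /HN /=; rewrite addn2 addn1 /D step !decayS rate0 rate1; lra.
have [c0 Hc0] := eventually_nondecreasing_bounded_below inc.
exists c0 => k t; rewrite -(odd_double_half k) -mul2n; move: k./2 => j.
case: (odd k); rewrite ?add1n ?add0n ?rate0 ?rate1.
  have := Hc0 j.+1; rewrite /D step !decayS rate0 rate1; lra.
have := Hc0 j; rewrite /D; lra.
Qed.

(** On the [k]-th interval the exponent of [weighted] is chosen to be the time
    spent in even phases, so that the functions of adjacent intervals agree at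
    the common end point and the bound [2 * eta] propagates. *)
Lemma lyapunov_bound (R : realType) (delta L q kap eta c0 b : R)
    (T : nat -> R) (A : R -> 'M[R]_2) (f : R -> 'cV[R]_2 -> 'cV[R]_2)
    (phi : R -> 'cV[R]_2) :
  T 0%N = 0 -> (forall k, T k < T k.+1) -> (forall M, exists k, M < T k) ->
  (forall k t, T k <= t < T k.+1 -> A t = phase delta k) ->
  (forall k t, T k <= t <= T k.+1 ->
    t / 2 - c0 <= (decay T k - rate R k * T k) + rate R k * t) ->
  0 <= L -> 1 < q -> 0 < kap ->
  4 * (1 + delta ^+ 2) * L * powR kap (q - 1) <= (q - 1) / 4 ->
  (forall t x, 0 <= t -> enorm x < kap ->
    enorm (f t x) <= L * powR (enorm x) q) ->
  {within `[0, b], continuous phi} ->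
  (forall t, 0 < t < b -> (forall k, t != T k) -> enorm (phi t) < kap ->
    is_derive t 1 phi (A t *m phi t + f t (phi t))) ->
  0 < eta -> 2 * eta * expR c0 <= kap ^+ 2 -> lyapunov delta (phi 0) < eta ->
  forall t, 0 <= t <= b -> lyapunov delta (phi t) <= 2 * eta * expR (c0 - t / 2).
Proof.
move=> T0 Tinc Tunb hA hdecay L0 q1 kap0 hsmall hf cphi dphi eta0 heta V0.
have Tge0 k : 0 <= T k.
  by elim: k => [|k IH]; [rewrite T0|exact: le_trans IH (ltW (Tinc k))].
pose c k := decay T k - rate R k * T k.
pose W k := weighted delta eta ((q - 1) / 4) (c k) (rate R k) phi.
have piece k d : T k <= d -> d <= T k.+1 -> d <= b -> W k (T k) < 2 * eta ->
    forall t, T k <= t <= d -> W k t <= W k (T k).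
  move=> Td dT db WT.
  apply: (@weighted_decay _ delta L q kap eta c0 (c k) (rate R k) (T k) d
    (phase delta k)) => //.
  - by move=> x; exact: phase_dissipative.
  - by move=> t /andP[t1 t2]; apply: hdecay; rewrite t1 (le_trans t2).
  - apply: continuous_subspaceW cphi => t /=; rewrite !in_itv/= => /andP[t1 t2].
    by rewrite (le_trans (Tge0 k) t1) (le_trans t2).
  move=> t /andP[t1 t2] nt; have tb : 0 < t < b.
    by rewrite (le_lt_trans (Tge0 k) t1) (lt_le_trans t2).
  exists (f t (phi t)); last by apply: hf => //; lra.
  rewrite -(hA k t); last by rewrite ltW//= (lt_le_trans t2).
  apply: dphi => // j; apply/eqP => tj.
  have Tmono : {homo T : i j / (i <= j)%N >-> i <= j}.
    by apply: homo_leq => [//|? ? ?|i]; [exact: le_trans|exact: ltW].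
  have [jk|kj] := leqP j k; first by have := Tmono _ _ jk; lra.
  by have := Tmono _ _ kj; lra.
have start k : T k <= b -> W k (T k) < 2 * eta.
  elim: k => [_|k IH Tb].
    rewrite /W /c /weighted /decay big_ord0 T0 !mulr0 subrr addr0 expR0; lra.
  have Tk := Tinc k; have Tb' : T k <= b by lra.
  have -> : W k.+1 (T k.+1) = W k (T k.+1).
    rewrite /W /weighted; congr (_ * expR _ + _).
    by rewrite /c decayS; ring.
  apply: le_lt_trans (IH Tb'); apply: (piece k (T k.+1)) => //; try exact: IH.
    exact: ltW.
  by rewrite ltW/=.
move=> t /andP[t0 tb].
have [|k /andP[Tt tT]] := @exists_interval _ T t _ (Tunb t); first by rewrite T0.
have Wk := start k (le_trans Tt tb).
have := piece k t Tt (ltW tT) tb Wk t; rewrite Tt lexx => /(_ isT) Wt.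
have hm : t / 2 - c0 <= c k + rate R k * t by apply: hdecay; rewrite Tt ltW.
move: (le_lt_trans Wt Wk); rewrite /W /weighted => Ht.
have G0 := expR_gt0 (0 + - ((q - 1) / 4) * t).
set E := expR (c k + rate R k * t) in Ht.
have -> : c0 - t / 2 = - (t / 2 - c0) by lra.
have E1 : 1 <= E * expR (- (t / 2 - c0)).
  by rewrite -expRD; apply: le_trans (expR_ge1Dx _); lra.
have V1 := lyapunov_ge0 delta (phi t).
have X0 := expR_gt0 (- (t / 2 - c0)).
have VE : lyapunov delta (phi t) * E <= 2 * eta.
  by have := mulr_gt0 eta0 G0; lra.
have := ler_wpM2r (ltW X0) VE; have := ler_wpM2l V1 E1; lra.
Qed.

(** Letting [eta] decrease to [lyapunov delta (phi 0)] in [lyapunov_bound]; the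
    limit also covers [phi 0 = 0]. *)
Lemma exponential_bound (R : realType) (delta L q kap c0 b : R)
    (T : nat -> R) (A : R -> 'M[R]_2) (f : R -> 'cV[R]_2 -> 'cV[R]_2)
    (phi : R -> 'cV[R]_2) :
  T 0%N = 0 -> (forall k, T k < T k.+1) -> (forall M, exists k, M < T k) ->
  (forall k t, T k <= t < T k.+1 -> A t = phase delta k) ->
  (forall k t, T k <= t <= T k.+1 ->
    t / 2 - c0 <= (decay T k - rate R k * T k) + rate R k * t) ->
  0 <= L -> 1 < q -> 0 < kap ->
  4 * (1 + delta ^+ 2) * L * powR kap (q - 1) <= (q - 1) / 4 ->
  (forall t x, 0 <= t -> enorm x < kap ->
    enorm (f t x) <= L * powR (enorm x) q) ->
  {within `[0, b], continuous phi} ->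
  (forall t, 0 < t < b -> (forall k, t != T k) -> enorm (phi t) < kap ->
    is_derive t 1 phi (A t *m phi t + f t (phi t))) ->
  4 * (1 + delta ^+ 2) * expR c0 * enorm (phi 0) ^+ 2 < kap ^+ 2 ->
  forall t, 0 <= t <= b ->
    enorm (phi t) <= Num.sqrt (2 * (1 + delta ^+ 2) * expR c0)
      * expR (- (1 / 4) * t) * enorm (phi 0).
Proof.
move=> T0 Tinc Tunb hA hdecay L0 q1 kap0 hsmall hf cphi dphi small t t0b.
set V0 := lyapunov delta (phi 0).
have C0 := expR_gt0 c0.
have d2 := sqr_ge0 delta.
have V0n : V0 <= (1 + delta ^+ 2) * enorm (phi 0) ^+ 2 := lyapunov_le_enorm _ _.
have V00 : 0 <= V0 := lyapunov_ge0 _ _.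
pose slack := (kap ^+ 2 - 4 * (1 + delta ^+ 2) * expR c0 * enorm (phi 0) ^+ 2)
   / (2 * expR c0).
have slack0 : 0 < slack by rewrite divr_gt0 ?mulr_gt0// subr_gt0.
have slackE : slack * (2 * expR c0) =
    kap ^+ 2 - 4 * (1 + delta ^+ 2) * expR c0 * enorm (phi 0) ^+ 2.
  by rewrite divfK// gt_eqF// mulr_gt0.
have V0C : V0 * expR c0 <= (1 + delta ^+ 2) * enorm (phi 0) ^+ 2 * expR c0.
  by rewrite ler_pM2r.
have n0 := sqr_ge0 (enorm (phi 0)).
have Vt : lyapunov delta (phi t) <= 2 * V0 * expR (c0 - t / 2).
  apply: (@le_of_small_error _ _ _ (2 * expR (c0 - t / 2)) slack) => // e e0 es.
  have eC : e * expR c0 <= slack * expR c0 by rewrite ler_pM2r.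
  have := @lyapunov_bound _ delta L q kap (V0 + e) c0 b T A f phi T0 Tinc Tunb
    hA hdecay L0 q1 kap0 hsmall hf cphi dphi _ _ _ t t0b.
  have P : 0 <= (1 + delta ^+ 2) * enorm (phi 0) ^+ 2 * expR c0.
    by apply: mulr_ge0; [apply: mulr_ge0; lra|exact: ltW].
  move=> H; have := H _ _ _; rewrite -/V0; lra.
set Y := 2 * (1 + delta ^+ 2) * expR c0.
have Y0 : 0 <= Y by apply: mulr_ge0; lra.
have K0 : 0 <= Num.sqrt Y * expR (- (1 / 4) * t) * enorm (phi 0).
  by rewrite !mulr_ge0 ?sqrtr_ge0 ?enorm_ge0// ltW// expR_gt0.
rewrite -(@ler_pXn2r _ 2) ?nnegrE ?enorm_ge0//.
apply: le_trans (enorm_le_lyapunov delta _) _; apply: le_trans Vt _.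
rewrite !exprMn sqr_sqrtr// -expRM_natl.
have -> : 2%:R * (- (1 / 4) * t) = - (t / 2) :> R by lra.
rewrite expRD /Y.
have X0 := expR_gt0 (- (t / 2)).
have -> : 2 * (1 + delta ^+ 2) * expR c0 * expR (- (t / 2)) * enorm (phi 0) ^+ 2
  = 2 * ((1 + delta ^+ 2) * enorm (phi 0) ^+ 2) * (expR c0 * expR (- (t / 2))).
  by ring.
by apply: ler_wpM2r; [rewrite mulr_ge0// ltW|lra].
Qed.

(** * Continuation of solutions *)

Lemma countable_setU (T : Type) (A B : set T) :
  countable A -> countable B -> countable (A `|` B).
Proof.
move=> cA cB; rewrite -bigcup2E; apply: bigcup_countable => //.
by move=> [|[|i]] _ //=; exact: countable0.
Qed.

Lemma ae_lebesgue_off_countable (R : realType) (E : set R) (P Q : R -> Prop) :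
  countable E -> (forall t, ~ E t -> P t -> Q t) ->
  {ae lebesgue_measure, forall t : R, P t} ->
  {ae lebesgue_measure, forall t : R, Q t}.
Proof.
move=> cE PQ [N [mN N0 subN]].
have mE : measurable E by apply: countable_measurable cE => t; exact: measurable_set1.
exists (N `|` E); split; first exact: measurableU.
  by rewrite measureU0//; exact: countable_lebesgue_measure0.
move=> t /= nQ; have [Et|nE] := pselect (E t); [by right|left].
by apply: subN => /= /(PQ _ nE).
Qed.

Lemma lipschitz_abs_continuous (R : realType) (phi : R -> 'cV[R]_2)
    (M a b : R) : 0 <= M ->
  (forall u v, a <= u -> u <= v -> v <= b -> `|phi v - phi u| <= M * (v - u)) ->
  abs_continuous_on a b phi.
Proof.
move=> M0 lip e e0; have M1 : 0 < 2 * M + 1 by lra.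
exists (e / (2 * M + 1)); first exact: divr_gt0.
move=> n u v uv _; rewrite ltr_pdivlMr// => small.
have H (i : 'I_n) : enorm (phi (v i) - phi (u i)) <= (v i - u i) * (2 * M).
  have [au [ui vb]] := uv i.
  by apply: le_trans (enorm_le_norm _) _; have := lip _ _ au ui vb; lra.
apply: le_lt_trans (ler_sum _ (fun i _ => H i)) _.
rewrite -mulr_suml.
have : 0 <= \sum_(i < n) (v i - u i).
  by apply: sumr_ge0 => i _; have [_ []] := uv i; rewrite subr_ge0.
lra.
Qed.

Lemma abs_continuous_continuous_within (R : realType) (phi : R -> 'cV[R]_2)
    (a b : R) :
  abs_continuous_on a b phi -> {within `[a, b], continuous phi}.
Proof.
move=> AC; apply/subspace_continuousP => t; rewrite /= in_itv/= => atb.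
apply/cvgrPdist_lt => e e0; rewrite near_withinE.
have [rho rho0 Hrho] := abs_continuous_cvg AC atb e0.
apply/nbhs_normP; exists rho => //= s; rewrite /ball_/= => ts.
by rewrite in_itv/= => asb; rewrite distrC; apply: Hrho => //; rewrite distrC.
Qed.

(** Setting the right-hand side to zero outside the ball of radius [kap] makes
    it bounded, and it keeps its points of continuity in the open ball. *)
Lemma truncated_solution (R : realType) (F : R -> 'cV[R]_2 -> 'cV[R]_2)
    (E : set R) (kap M b : R) (x0 : 'cV[R]_2) :
  0 <= M -> 0 <= b ->
  (forall t y, 0 <= t -> `|y| < kap -> `|F t y| <= M) ->
  (forall t y, 0 < t -> ~ E t -> `|y| < kap -> jointly_continuous_at F t y) ->
  exists y : R -> 'cV[R]_2, [/\ y b = x0,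
    forall u v, b <= u -> u <= v -> `|y v - y u| <= M * (v - u) &
    forall s, b < s -> ~ E s -> `|y s| < kap -> is_derive s 1 y (F s (y s))].
Proof.
move=> M0 b0 FM Fc.
pose G t y := if `|y| < kap then F t y else 0.
have GM t y : b <= t -> `|G t y| <= M.
  move=> bt; rewrite /G; case: ifP => [ykap|_]; last by rewrite normr0.
  by apply: FM => //; exact: le_trans bt.
have [y [yb ylip dy]] := exists_lipschitz_solution x0 GM.
exists y; split => // s bs nEs ys.
have GE : G s (y s) = F s (y s) by rewrite /G ys.
rewrite -GE; apply: dy => // e e0.
have [rho rho0 Hrho] := Fc s (y s) (le_lt_trans b0 bs) nEs ys e e0.
exists (Num.min rho (kap - `|y s|)); first by rewrite lt_min rho0 subr_gt0.
move=> t z; rewrite !lt_min => /andP[t1 _] /andP[z1 z2].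
have zkap : `|z| < kap.
  have -> : z = (z - y s) + y s by rewrite subrK.
  by apply: le_lt_trans (ler_normD _ _) _; lra.
by rewrite GE /G zkap; exact: Hrho.
Qed.

Lemma forward_solution_bounded (R : realType) (A : R -> 'M[R]_2)
    (f : R -> 'cV[R]_2 -> 'cV[R]_2) (x0 : 'cV[R]_2) (J : set R)
    (phi : R -> 'cV[R]_2) :
  forward_solution A f x0 J phi -> J != [set t | 0 <= t] ->
  exists c, forall t, J t -> t < c.
Proof.
move=> [[itvJ J0] [JJ0 _] _ _] /eqP JN.
have [c [c0 Jc]] : exists c, 0 <= c /\ ~ J c.
  apply: contrapT => H; apply: JN; apply/seteqP; split => // t t0.
  by apply: contrapT => nJ; apply: H; exists t.
exists c => t Jt; rewrite ltNge; apply/negP => ct; apply: Jc.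
by apply: (itvJ 0 t) => //; rewrite c0.
Qed.

(** A small solution is Lipschitz, so it has a limit [xb] at the right end
    [b] of its interval.  A truncated solution that starts at [xb] at time [b]
    stays small for some time [d], and joining it to [phi] gives a solution on
    [0, b + d]. *)
Lemma forward_solution_continuation (R : realType) (A : R -> 'M[R]_2)
    (f : R -> 'cV[R]_2 -> 'cV[R]_2) (E : set R) (kap M : R) (x0 : 'cV[R]_2)
    (J : set R) (phi : R -> 'cV[R]_2) :
  let F t y := A t *m y + f t y in
  countable E -> 0 < kap -> 0 <= M ->
  (forall t y, 0 <= t -> `|y| < kap -> `|F t y| <= M) ->
  (forall t y, 0 < t -> ~ E t -> `|y| < kap -> jointly_continuous_at F t y) ->
  forward_solution A f x0 J phi -> (forall t, J t -> `|phi t| <= kap / 2) ->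
  J != [set t | 0 <= t] ->
  exists (J' : set R) (psi : R -> 'cV[R]_2),
    [/\ forward_solution A f x0 J' psi, J `<=` J',
        forall t, J t -> psi t = phi t & J' != J].
Proof.
move=> F cE kap0 M0 FM Fc sol phikap JN.
have [c Jc] := forward_solution_bounded sol JN.
have [[itvJ J0] [JJ0 phi0] AC dphi] := sol.
have lip u v : J u -> J v -> u <= v -> `|phi v - phi u| <= M * (v - u).
  move=> Ju Jv uv.
  have -> : phi v - phi u = phi v - phi u - (v - u) *: 0 by rewrite scaler0 subr0.
  apply: (@abs_continuous_increment _ phi u v 0 M) => //; first exact: AC.
  move: dphi; apply: ae_lebesgueS => t dt utv.
  have Jt : J t by apply: (itvJ u v).
  exists (F t (phi t)); first exact: dt.
  rewrite subr0; apply: FM; first exact: J0.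
  by apply: le_lt_trans (phikap _ Jt) _; lra.
have supJ : has_sup J by split; [exists 0|exists c => t /Jc/ltW].
pose b := sup J.
have Jb t : J t -> t <= b by move=> Jt; exact: sup_upper_bound.
have b0 : 0 <= b := Jb _ JJ0.
have Jlt t : 0 <= t -> t < b -> J t.
  move=> t0 tb; have bt : 0 < b - t by rewrite subr_gt0.
  have [t' Jt' tt'] := sup_adherent bt supJ.
  by apply: (itvJ 0 t') => //; rewrite t0; rewrite -/b in tt'; lra.
have [xb Hxb] : exists xb : 'cV[R]_2, forall t, J t -> `|xb - phi t| <= M * (b - t).
  (* Each entry plus [M * t] is nondecreasing on [J], so its limit at [b] is a
     supremum; this covers both [b] in [J] and [b] outside [J]. *)
  pose S i := [set phi t i ord0 + M * t | t in J].
  have S_le i t t' : J t -> J t' ->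
      phi t' i ord0 + M * t' <= phi t i ord0 + M * (2 * b - t).
    move=> Jt Jt'; have tb := Jb _ Jt; have tb' := Jb _ Jt'.
    have [tt'|t't] := leP t t'.
      have := le_trans (norm_entry _ i) (lip _ _ Jt Jt' tt').
      rewrite !mxE ler_norml => /andP[_]; nra.
    have := le_trans (norm_entry _ i) (lip _ _ Jt' Jt (ltW t't)).
    rewrite !mxE ler_norml => /andP[+ _]; nra.
  have supS i : has_sup (S i).
    split; first by exists (phi 0 i ord0 + M * 0), 0.
    exists (phi 0 i ord0 + M * (2 * b - 0)) => _ [t Jt <-]; exact: S_le.
  exists (\col_i (sup (S i) - M * b)) => t Jt.
  apply: norm_le_entries; first by apply: mulr_ge0 => //; rewrite subr_ge0 Jb.
  move=> i; rewrite !mxE.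
  have low : phi t i ord0 + M * t <= sup (S i).
    by apply: sup_upper_bound => //; exists t.
  have up : sup (S i) <= phi t i ord0 + M * (2 * b - t).
    by apply: ge_sup; [case: (supS i)|move=> _ [t' Jt' <-]; exact: S_le].
  rewrite ler_norml; lra.
have xbkap : `|xb| <= kap / 2.
  apply: (@le_of_small_error _ _ _ M 1) => // e e0 _.
  have [t Jt bt] := sup_adherent e0 supJ; rewrite -/b in bt.
  have -> : xb = (xb - phi t) + phi t by rewrite subrK.
  apply: le_trans (ler_normD _ _) _.
  have := Hxb t Jt; have := phikap t Jt; have := Jb t Jt; nra.
have [y [yb ylip dy]] := truncated_solution xb M0 b0 FM Fc.
(* Velocity at most [M] for a time [d] adds less than [kap / 2]. *)
pose d := kap / (4 * (M + 1)).
have M4 : 0 < 4 * (M + 1) by lra.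
have d0 : 0 < d by apply: divr_gt0.
have dE : d * (4 * (M + 1)) = kap by rewrite divfK// gt_eqF.
pose psi t := if t \in J then phi t else y t.
have psiJ t : J t -> psi t = phi t by move=> Jt; rewrite /psi mem_set.
have psiN t : ~ J t -> psi t = y t by move=> nJ; rewrite /psi memNset.
have psilip u v : 0 <= u -> u <= v -> `|psi v - psi u| <= M * (v - u).
  move=> u0 uv; have [Ju|nJu] := pselect (J u); have [Jv|nJv] := pselect (J v).
  - by rewrite !psiJ//; exact: lip.
  - rewrite (psiJ u)// (psiN v)//.
    have bv : b <= v by rewrite leNgt; apply/negP => /(Jlt _ (le_trans u0 uv)).
    have -> : y v - phi u = (y v - y b) + (xb - phi u) by rewrite yb addrA subrK.
    apply: le_trans (ler_normD _ _) _.
    have := ylip b v (lexx b) bv; have := Hxb u Ju; lra.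
  - by exfalso; apply: nJu; apply: (itvJ 0 v) => //; rewrite u0.
  - rewrite !psiN//; apply: ylip => //.
    by rewrite leNgt; apply/negP => /(Jlt _ u0).
pose J' := [set t | 0 <= t <= b + d].
have JJ' : J `<=` J'.
  by move=> t Jt; apply/andP; split; [exact: J0|have := Jb _ Jt; lra].
exists J', psi; split => //; last first.
  apply/eqP => JE; have : J' (b + d) by rewrite /J'/=; lra.
  rewrite JE => /Jb; lra.
split.
- split; last by move=> t /andP[].
  move=> s t /andP[s0 _] /andP[_ tb] u /andP[su ut].
  by rewrite /J'/= (le_trans s0 su) (le_trans ut tb).
- by split; [exact: JJ'|rewrite psiJ].
- move=> u v /andP[u0 _] _ _; apply: (@lipschitz_abs_continuous _ _ M) => //.
  by move=> s t us st _; apply: psilip => //; exact: le_trans us.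
have cE' : countable (E `|` [set 0] `|` [set b]).
  by apply: countable_setU (countable1 b); exact: countable_setU (countable1 0).
move: dphi; apply: (ae_lebesgue_off_countable cE') => t nE dt /andP[t0 tbd].
have {nE} [[nE nt0] ntb] : (~ E t /\ t != 0) /\ t != b.
  split; [split|].
  - by move=> Et; apply: nE; left; left.
  - by apply/eqP => te; apply: nE; left; right.
  - by apply/eqP => te; apply: nE; right.
have {nt0} tpos : 0 < t by rewrite lt_neqAle eq_sym nt0.
have [tb|] := ltP t b.
  have Jt := Jlt t t0 tb.
  rewrite (psiJ t)//; apply: near_eq_is_derive (dt Jt).
  apply/nbhs_normP; exists (Num.min t (b - t)).
    by rewrite /= lt_min tpos subr_gt0.
  move=> s; rewrite /ball_/= distrC lt_min !ltr_norml => ts.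
  by rewrite psiJ//; apply: Jlt; lra.
rewrite le_eqVlt eq_sym (negbTE ntb)/= => bt.
have nJ s : b < s -> ~ J s by move=> bs /Jb; lra.
rewrite (psiN t (nJ t bt)).
have ykap : `|y t| < kap.
  have -> : y t = (y t - y b) + xb by rewrite yb subrK.
  apply: le_lt_trans (ler_normD _ _) _.
  have := ylip b t (lexx b) (ltW bt); nra.
apply: near_eq_is_derive (dy t bt nE ykap).
apply/nbhs_normP; exists (t - b); first by rewrite /= subr_gt0.
move=> s; rewrite /ball_/= distrC !ltr_norml => ts.
by rewrite psiN//; apply: nJ; lra.
Qed.

(** * The right-hand side and exponential stability *)

Lemma phase_norm (R : realType) (delta : R) (k : nat) (x : 'cV[R]_2) :
  0 <= delta -> `|phase delta k *m x| <= (1 + delta) * `|x|.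
Proof.
move=> d0; have n0 := normr_ge0 x.
have K0 := norm_entry x ord0; have K1 := norm_entry x (lift ord0 ord0).
apply: norm_le_entries => [|i]; first by apply: mulr_ge0; lra.
rewrite ler_norml in K0; rewrite ler_norml in K1.
rewrite ler_norml /phase; case: (unliftP ord0 i) => [j ->|->];
  rewrite ?(ord1 j); case: odd; rewrite ?mx2_mul0 ?mx2_mul1; nra.
Qed.

Lemma phase_of_time (R : realType) (delta : R) (T : nat -> R) (A : R -> 'M[R]_2) :
  (forall k t, T (2 * k)%N <= t < T (2 * k + 1)%N -> A t = mx2 (-1) delta 0 (-1)) ->
  (forall k t, T (2 * k + 1)%N <= t < T (2 * k + 2)%N -> A t = mx2 (-1) 0 0 0) ->
  forall k t, T k <= t < T k.+1 -> A t = phase delta k.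
Proof.
move=> hA1 hA2 k t; rewrite /phase -[in T _ <= _](odd_double_half k).
rewrite -[in T k.+1](odd_double_half k) -mul2n.
case: odd => ht.
  by apply: (hA2 k./2); rewrite addn1 addn2; move: ht; rewrite add1n.
by apply: (hA1 k./2); rewrite addn1; move: ht; rewrite add0n.
Qed.

(** Away from the [T k] the matrix is locally constant in time. *)
Lemma rhs_jointly_continuous (R : realType) (delta : R) (T : nat -> R)
    (A : R -> 'M[R]_2) (f : R -> 'cV[R]_2 -> 'cV[R]_2) (t : R) (y : 'cV[R]_2) :
  0 <= delta -> T 0%N = 0 -> (forall M, exists k, M < T k) ->
  (forall k t, T k <= t < T k.+1 -> A t = phase delta k) ->
  {within [set p : R * 'cV[R]_2 | 0 <= p.1],
     continuous (fun p : R * 'cV[R]_2 => f p.1 p.2)} ->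
  0 < t -> ~ range T t ->
  jointly_continuous_at (fun t y => A t *m y + f t y) t y.
Proof.
move=> d0 T0 Tunb hA /subspace_continuousP cf t0 nT e e0.
have [|k /andP[Tt tT]] := @exists_interval _ T t _ (Tunb t); first by rewrite T0 ltW.
have {}Tt : T k < t.
  by rewrite lt_neqAle Tt andbT; apply/eqP => Tk; apply: nT; exists k.
have e2 : 0 < e / 2 by lra.
have /cvgrPdist_lt/(_ _ e2) :=
  cf (t, y) (ltW t0 : [set p : R * 'cV[R]_2 | 0 <= p.1] (t, y)).
rewrite near_withinE => /nbhs_ballP[rho /= rho0 Hrho].
pose m := Num.min (Num.min rho t)
  (Num.min (Num.min (t - T k) (T k.+1 - t)) (e / (2 * (1 + delta)))).
have D0 : 0 < 2 * (1 + delta) by lra.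
have m0 : 0 < m by rewrite !lt_min rho0 t0 divr_gt0// !subr_gt0 Tt tT.
have [m1 m2 m3 m4 m5] : [/\ m <= rho, m <= t, m <= t - T k,
    m <= T k.+1 - t & m <= e / (2 * (1 + delta))].
  by rewrite /m !ge_min !lexx !orbT.
rewrite ler_pdivlMr// in m5.
exists m => // s z; rewrite ltr_norml => ts zy.
have As : A s = phase delta k by apply: hA; lra.
have At : A t = phase delta k by apply: hA; lra.
rewrite As At.
have -> : phase delta k *m z + f s z - (phase delta k *m y + f t y) =
    phase delta k *m (z - y) + (f s z - f t y).
  by rewrite mulmxBr opprD addrACA.
apply: le_trans (ler_normD _ _) _.
have K1 := phase_norm k (z - y) d0.
have K2 : `|f s z - f t y| < e / 2.
  rewrite distrC; apply: (Hrho (s, z)); last by rewrite /=; lra.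
  split => /=.
    by rewrite -ball_normE /ball_/= distrC ltr_norml; lra.
  by rewrite -ball_normE /ball_/= distrC; lra.
nra.
Qed.

Lemma rhs_bounded (R : realType) (delta : R) (T : nat -> R)
    (A : R -> 'M[R]_2) (f : R -> 'cV[R]_2 -> 'cV[R]_2) (r L q kap : R)
    (t : R) (y : 'cV[R]_2) :
  0 <= delta -> T 0%N = 0 -> (forall M, exists k, M < T k) ->
  (forall k t, T k <= t < T k.+1 -> A t = phase delta k) ->
  (forall t x, 0 <= t -> enorm x < r ->
    enorm (f t x) <= L * powR (enorm x) q) ->
  0 <= L -> 0 <= q -> 2 * kap < r -> 0 <= t -> `|y| < kap ->
  `|A t *m y + f t y| <= (1 + delta) * kap + L * powR (2 * kap) q.
Proof.
move=> d0 T0 Tunb hA hf L0 q0 kapr t0 ykap.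
have [|k Tt] := @exists_interval _ T t _ (Tunb t); first by rewrite T0.
have yk := enorm_le_norm y.
apply: le_trans (ler_normD _ _) _; apply: lerD.
  rewrite (hA _ _ Tt); apply: le_trans (phase_norm _ _ d0) _.
  by apply: ler_wpM2l; lra.
apply: le_trans (norm_le_enorm _) _; apply: le_trans (hf t y t0 _) _; first lra.
apply: ler_wpM2l => //; apply: ge0_ler_powR => //; rewrite ?nnegrE ?enorm_ge0//.
  by have := normr_ge0 y; lra.
lra.
Qed.

(** Eventually [exp S < l] for the length [S] of the odd phase and the length
    [l] of the even phase before it, and [S <= exp S]. *)
Lemma short_phases (R : realType) (T : nat -> R) :
  (forall k, T k < T k.+1) ->
  (expR (T (2 * k + 2)%N - T (2 * k + 1)%N)
     / (T (2 * k + 1)%N - T (2 * k)%N)) @[k --> \oo] --> (0 : R) ->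
  \forall k \near \oo,
    T (2 * k + 2)%N - T (2 * k + 1)%N <= T (2 * k + 1)%N - T (2 * k)%N.
Proof.
move=> Tinc /cvgrPdist_lt/(_ 1 ltr01); apply: filterS => k /=.
rewrite sub0r normrN => H.
have l0 : 0 < T (2 * k + 1)%N - T (2 * k)%N by rewrite subr_gt0 addn1.
have := le_lt_trans (ler_norm _) H; rewrite ltr_pdivrMr// mul1r.
have := expR_ge1Dx (T (2 * k + 2)%N - T (2 * k + 1)%N); lra.
Qed.

Lemma exists_small_radius (R : realType) (r C q : R) :
  0 < r -> 0 < C -> 1 < q ->
  exists kap : R, [/\ 0 < kap, 2 * kap < r & C * powR kap (q - 1) <= (q - 1) / 4].
Proof.
move=> r0 C0 q1; pose g := (q - 1) / 4 / C.
have g0 : 0 < g by rewrite !divr_gt0//; lra.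
exists (Num.min (r / 3) (powR g (q - 1)^-1)); split.
- by rewrite lt_min powR_gt0// andbT; lra.
- apply: le_lt_trans (_ : 2 * (r / 3) < r); last by lra.
  by rewrite ler_pM2l// ge_min lexx.
rewrite mulrC -ler_pdivlMr// -/g.
have gE : powR (powR g (q - 1)^-1) (q - 1) = g.
  by rewrite -powRrM mulVf ?powRr1 ?ltW// gt_eqF//; lra.
rewrite -[leRHS]gE; apply: ge0_ler_powR; rewrite ?nnegrE ?powR_ge0//; first by lra.
  by rewrite le_min powR_ge0 andbT; lra.
by rewrite ge_min lexx orbT.
Qed.

Theorem proposition29 (R : realType) (delta : R) (T : nat -> R)
    (A : R -> 'M[R]_2) (f : R -> 'cV[R]_2 -> 'cV[R]_2) (r L q : R)
    (hdelta : 0 < delta)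
    (hTincr : forall k : nat, T k < T k.+1)
    (hTge0 : forall k : nat, 0 <= T k)
    (hT0 : T 0%N = 0)
    (hTgap : (T k.+1 - T k) @[k --> \oo] --> +oo)
    (hTratio :
       (expR (T (2 * k + 2)%N - T (2 * k + 1)%N)
          / (T (2 * k + 1)%N - T (2 * k)%N)) @[k --> \oo] --> (0 : R))
    (hA1 : forall (k : nat) (t : R), T (2 * k)%N <= t < T (2 * k + 1)%N ->
       A t = mx2 (-1) delta 0 (-1))
    (hA2 : forall (k : nat) (t : R), T (2 * k + 1)%N <= t < T (2 * k + 2)%N ->
       A t = mx2 (-1) 0 0 0)
    (hf : {within [set p : R * 'cV[R]_2 | 0 <= p.1],
             continuous (fun p : R * 'cV[R]_2 => f p.1 p.2)})
    (hr : 0 < r) (hL : 1 <= L) (hq : 1 < q)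
    (hfbound : forall (t : R) (x : 'cV[R]_2), 0 <= t -> enorm x < r ->
       enorm (f t x) <= L * powR (enorm x) q) :
  exponentially_stable A f.
Proof.
have d0 := ltW hdelta.
have L0 : 0 <= L by lra.
have D1 : 0 < 1 + delta ^+ 2 by have := sqr_ge0 delta; lra.
have Tunb := unbounded_of_gap hTgap.
have hA := phase_of_time hA1 hA2.
have [c0 hdecay] := decay_rate_half hTincr (short_phases hTincr hTratio).
have [kap [kap0 kapr hsmall]] : exists kap : R, [/\ 0 < kap, 2 * kap < r &
    4 * (1 + delta ^+ 2) * L * powR kap (q - 1) <= (q - 1) / 4].
  by apply: exists_small_radius => //; rewrite !mulr_gt0//; lra.
pose F t y := A t *m y + f t y.
pose M := (1 + delta) * kap + L * powR (2 * kap) q.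
have M0 : 0 <= M by rewrite addr_ge0 ?mulr_ge0 ?powR_ge0//; lra.
have FM t y : 0 <= t -> `|y| < kap -> `|F t y| <= M.
  move=> t0 yk; have q0 : 0 <= q by lra.
  exact: (rhs_bounded d0 hT0 Tunb hA hfbound L0 q0 kapr t0 yk).
have Fc t y : 0 < t -> ~ range T t -> jointly_continuous_at F t y.
  by move=> t0 nT; exact: (rhs_jointly_continuous y d0 hT0 Tunb hA hf t0 nT).
have hfkap t x : 0 <= t -> enorm x < kap -> enorm (f t x) <= L * powR (enorm x) q.
  by move=> t0 xk; apply: hfbound => //; lra.
pose K := Num.sqrt (2 * (1 + delta ^+ 2) * expR c0).
have C0 := expR_gt0 c0.
have K0 : 0 < K by rewrite sqrtr_gt0 !mulr_gt0.
have K2 : K ^+ 2 = 2 * (1 + delta ^+ 2) * expR c0.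
  by rewrite sqr_sqrtr// !mulr_ge0// ltW.
(* For [|phi 0| < kap / (2 * K)] the exponential bound also keeps [phi] within
   [kap / 2], well inside the ball where the right-hand side is controlled. *)
have bound (phi : R -> 'cV[R]_2) (b : R) :
    enorm (phi 0) < kap / (2 * K) ->
    abs_continuous_on 0 b phi ->
    (forall t, 0 < t < b -> ~ range T t -> enorm (phi t) < kap ->
      is_derive t 1 phi (F t (phi t))) ->
    forall t, 0 <= t <= b ->
      enorm (phi t) <= K * expR (- (1 / 4) * t) * enorm (phi 0) /\
      enorm (phi t) <= kap / 2.
  move=> phi0 AC dphi t t0b.
  have n0 := enorm_ge0 (phi 0).
  rewrite ltr_pdivlMr ?mulr_gt0// in phi0.
  have Kn : 0 <= K * enorm (phi 0) by apply: mulr_ge0 => //; exact: ltW.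
  have H : enorm (phi t) <= K * expR (- (1 / 4) * t) * enorm (phi 0).
    apply: (@exponential_bound _ delta L q kap c0 b T A f) => //.
    - exact: abs_continuous_continuous_within.
    - move=> s s0b nT; apply: dphi => // -[k _ Ts].
      by have := nT k; rewrite Ts eqxx.
    - have -> : 4 * (1 + delta ^+ 2) * expR c0 * enorm (phi 0) ^+ 2 =
          2 * (K * enorm (phi 0)) ^+ 2.
        by rewrite exprMn K2; ring.
      have : K * enorm (phi 0) < kap / 2 by lra.
      move: (K * enorm (phi 0)) Kn => z z0 zk.
      have z2 : z ^+ 2 <= (kap / 2) ^+ 2 by rewrite lerXn2r ?nnegrE; lra.
      have := exprn_gt0 2 kap0; lra.
  split => //; apply: le_trans H _.
  have e1 : expR (- (1 / 4) * t) <= 1 by rewrite expR_le1; lra.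
  have := ler_wpM2l Kn e1; lra.
have cT : countable (range T) by apply: card_le_trans (card_image_le _ _) _.
exists K, (1 / 4), (kap / (2 * K)); split;
  [exact: K0|lra|by rewrite divr_gt0 ?mulr_gt0|].
move=> x xsmall; split.
  (* A solution on the whole half-line is maximal. *)
  have [y [y0 ylip dy]] :=
    truncated_solution x M0 (lexx 0) FM (fun t y t0 nT _ => Fc t y t0 nT).
  have ylip' u v : 0 <= u -> u <= v -> `|y v - y u| <= M * (v - u) by exact: ylip.
  have ACy a b : 0 <= a -> abs_continuous_on a b y.
    move=> a0; apply: (lipschitz_abs_continuous M0) => u v au uv _.
    by apply: ylip => //; exact: le_trans au.
  have ykap t : 0 <= t -> enorm (y t) < kap.
    move=> t0; rewrite -y0 in xsmall.
    have [||_] := bound y t xsmall (ACy 0 t (lexx 0)) _ t.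
    - move=> s /andP[s0 _] nT sk; apply: dy => //.
      exact: le_lt_trans (norm_le_enorm _) sk.
    - by rewrite t0 lexx.
    - lra.
  exists [set t | 0 <= t], y; split; last first.
    move=> J' psi [[_ J'0] _ _ _] sub _; exact/seteqP.
  split => //.
  - by split => // u v u0 _ w /andP[uw _]; exact: le_trans uw.
  - by split => //=.
  - by move=> a b a0 _ _; exact: ACy.
  have cE : countable (range T `|` [set 0]) by exact: countable_setU (countable1 0).
  apply: (@ae_lebesgue_off_countable _ _ (fun=> True) _ cE); last exact: aeW.
  move=> t nE _ t0; apply: dy.
  - rewrite lt_neqAle (t0 : 0 <= t) andbT; apply/eqP => te.
    by apply: nE; right; exact/esym.
  - by move=> Tt; apply: nE; left.
  - exact: le_lt_trans (norm_le_enorm _) (ykap t t0).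
move=> J phi [sol maxi].
have [[itvJ J0] [JJ0 phi0] AC dphi] := sol.
have est t : J t -> enorm (phi t) <= K * expR (- (1 / 4) * t) * enorm (phi 0)
      /\ enorm (phi t) <= kap / 2.
  move=> Jt; have t0 : 0 <= t := J0 _ Jt.
  have ACt : abs_continuous_on 0 t phi by exact: AC.
  have xs : enorm (phi 0) < kap / (2 * K) by rewrite phi0.
  apply: (bound phi t xs ACt); last by rewrite t0 lexx.
  move=> s s0t nT _; apply: (abs_continuous_solution_is_derive ACt _ s0t).
    move: dphi; apply: ae_lebesgueS => u du /andP[u0 ut]; apply: du.
    by apply: (itvJ 0 t) => //; rewrite u0.
  by apply: Fc => //; case/andP: s0t.
have JE : J = [set t | 0 <= t].
  apply/eqP; apply: contraT => JN.
  have Jkap t : J t -> `|phi t| <= kap / 2.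
    by move=> /est[_]; apply: le_trans (norm_le_enorm _).
  have [J' [psi [sol' JJ' ext]]] := forward_solution_continuation cT kap0 M0 FM
    (fun t y t0 nT _ => Fc t y t0 nT) sol Jkap JN.
  by rewrite (maxi J' psi sol' JJ' ext) eqxx.
split => // t t0; rewrite -phi0; apply: (est t _).1.
by rewrite JE.
Qed.
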